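(* Fix a real number $\alpha>0$ and an integer $n\ge1$. A wave $u(x,t)$ on $S^n$ is uniquely determined by its snapshots $u_0$ and $u_\alpha$ provided that either (1) $\alpha/\pi$ is irrational, or (2) $\alpha/\pi$ is a rational number $p/q$ in lowest terms, $n$ is even, and $p$ is odd. On the other hand, suppose that $\alpha/\pi$ is a rational number $p/q$ in lowest terms, with either $p$ even or $n$ odd. Then for any wave $u$ on $S^n$ there are uncountably many waves on $S^n$ having the same snapshots $u_0$ and $u_\alpha$ at times $0$ and $\alpha$.
   Context: $S^n$ is the unit sphere in $\mathbb R^{n+1}$ with the induced Riemannian metric, and $\Delta_{S^n}$ its Laplace–Beltrami operator. A wave on $S^n$ is a (complex-valued) solution $u\in C^\infty(S^n\times\mathbb R)$ of the shifted wave equation $\left(\Delta_{S^n}-\left(\frac{n-1}2\right)^2\right)u(x,t)=\frac{\partial^2}{\partial t^2}u(x,t)$; its snapshot at time $t$ is $u_t(x)=u(x,t)$. *)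

(* Defs.v *)
From HB Require Import structures.
From mathcomp Require Import all_boot all_order all_algebra.
From mathcomp Require Import all_classical all_reals all_analysis.
From mathcomp Require Import complex.

Set Implicit Arguments.
Unset Strict Implicit.
Unset Printing Implicit Defensive.

Import Order.TTheory GRing.Theory Num.Theory.
Import numFieldNormedType.Exports.

Local Open Scope classical_set_scope.
Local Open Scope ring_scope.

Section Sphere.
Context {R : realType}.

(* The norm the library puts on 'rV[R]_n is the sup norm, hence this one. *)
Definition eucl_norm m (x : 'rV[R]_m) : R := Num.sqrt (\sum_i x 0 i ^+ 2).

Definition sphere (n : nat) : Type := {x : 'rV[R]_n.+1 | eucl_norm x == 1}.

Lemma eucl_norm_delta m (i : 'I_m) : eucl_norm (delta_mx 0 i) == 1.
Proof.
rewrite /eucl_norm (bigD1 i) //= big1 => [|j /negPf ji].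
  by rewrite mxE !eqxx expr1n addr0 sqrtr1.
by rewrite mxE ji andbF expr0n.
Qed.

Definition pole n : sphere n :=
  exist _ (delta_mx 0 ord0) (eucl_norm_delta ord0).

(* x |-> x / |x|; the value at x = 0 is irrelevant. *)
Definition retract n (x : 'rV[R]_n.+1) : sphere n :=
  insubd (pole n) ((eucl_norm x)^-1 *: x).

Lemma retract_val n (x : sphere n) : retract (val x) = x.
Proof.
apply: val_inj; rewrite /retract (eqP (valP x)) invr1 scale1r insubdK //.
exact: valP.
Qed.

(* Derivative of f at x along the orthogonal projection of v to the tangent
   space at x: s |-> retract (x + s v) is a curve on the sphere passing
   through x at s = 0 with velocity v - <x, v> x. *)
Definition tderive n (f : sphere n -> R) (v : 'rV[R]_n.+1) (x : sphere n) : R :=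
  'D_v (f \o @retract n) (val x).

(* Riemannian gradient, as a tangent vector in ambient coordinates: it is the
   tangent vector whose inner product with any v is tderive f v x. *)
Definition grad n (f : sphere n -> R) (x : sphere n) : 'rV[R]_n.+1 :=
  \row_i tderive f (delta_mx 0 i) x.

(* Riemannian divergence of a tangent field V. The Levi-Civita connection of
   the induced metric is nabla_w V = P (D_w V), with P the orthogonal
   projection to the tangent space, so the trace of nabla V is that of
   v |-> D_(P v) V, computed here in the ambient orthonormal basis. *)
Definition divergence n (V : sphere n -> 'rV[R]_n.+1) (x : sphere n) : R :=
  \sum_i tderive (fun y => V y 0 i) (delta_mx 0 i) x.

Definition laplace_beltrami n (f : sphere n -> R) : sphere n -> R :=
  divergence (grad f).

(* C^oo on an open set A: all iterated directional derivatives exist and are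
   Frechet differentiable (hence continuous) at every point of A. *)
Definition smooth_on (V : normedModType R) (A : set V) (F : V -> R) : Prop :=
  forall (vs : seq V) (p : V), A p ->
    differentiable (foldr (fun v G => 'D_v G) F vs) p.

(* C^oo on the submanifold S^n x R of R^(n+1) x R: local smooth extensions. *)
Definition smooth_sphere_time n (u : sphere n -> R -> R) : Prop :=
  forall (x : sphere n) (t : R),
    exists (A : set ('rV[R]_n.+1 * R)) (F : 'rV[R]_n.+1 * R -> R),
      [/\ open_nbhs (val x, t) A, smooth_on A F &
          forall (y : sphere n) (s : R), A (val y, s) -> F (val y, s) = u y s].

Definition snapshot n (u : sphere n -> R -> R[i]) (t : R) : sphere n -> R[i] :=
  fun x => u x t.

(* Differential operators act on complex-valued functions through the real
   and imaginary parts. *)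
Definition laplace_beltramiC n (f : sphere n -> R[i]) (x : sphere n) : R[i] :=
  (laplace_beltrami (fun y => complex.Re (f y)) x
   +i* laplace_beltrami (fun y => complex.Im (f y)) x)%C.

Definition derive2C (g : R -> R[i]) (t : R) : R[i] :=
  (derive1n 2 (fun s => complex.Re (g s)) t
   +i* derive1n 2 (fun s => complex.Im (g s)) t)%C.

Definition wave n (u : sphere n -> R -> R[i]) : Prop :=
  [/\ smooth_sphere_time (fun x t => complex.Re (u x t)),
      smooth_sphere_time (fun x t => complex.Im (u x t)) &
      forall (x : sphere n) (t : R),
        laplace_beltramiC (snapshot u t) x
          - (((n%:R - 1) / 2) ^+ 2)%:C%C * u x t
        = derive2C (u x) t].

End Sphere.

Arguments sphere R n : clear implicits.

Definition lowest_terms {R : realType} (x : R) (p q : nat) : Prop :=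
  [/\ (0 < q)%N, coprime p q & x = p%:R / q%:R].

(* Main.v *)
(** Extended to R^(n+1) minus the origin by homogeneity of degree 0, a function on
    the sphere is differentiated by the operators T_i = |x| d/dx_i, and the
    Laplace-Beltrami operator is the sum of the T_i o T_i.

    Uniqueness. Let w be the difference of two waves, y a point of the sphere and
    s(x) = <x, y>. Since Delta s^k = k(k-1) s^(k-2) - k(k+n-1) s^k, Green's formula
    shows that the moments m_k(t) of w(., t) against s^k satisfy
      m_k'' = - (k + (n-1)/2)^2 m_k + k(k-1) m_(k-2),  m_k(0) = m_k(alpha) = 0.
    Unless sin((k + (n-1)/2) alpha) = 0, induction on k gives m_k = 0 for all k, and
    testing against the kernels ((1 + s)/2)^N, which peak at y, gives w(y, t) = 0.

    All that is needed of integration over the sphere is a positive linear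
    functional that kills divergences of tangent fields. It is obtained by
    averaging the homogeneous extension, times a radial cutoff, over finer and
    finer cubic grids, and taking the limit along an ultrafilter: a sum of
    difference quotients over a grid telescopes, so derivatives of functions
    with compact support have limit 0.

    Non-uniqueness. At a resonant degree k, where lambda = k + (n-1)/2 is positive
    and sin(lambda alpha) = 0, every multiple of Re((x_0 + i x_n)^k) sin(lambda t) can
    be added to a wave without changing its two snapshots. *)

From HB Require Import structures.
Require Import Defs.
From mathcomp Require Import all_boot all_order all_algebra.
From mathcomp Require Import all_classical all_reals all_analysis.
From mathcomp Require Import complex.
From mathcomp Require Import ring lra zify.

Set Implicit Arguments.
Unset Strict Implicit.
Unset Printing Implicit Defensive.

Import Order.TTheory GRing.Theory Num.Theory.
Import numFieldNormedType.Exports.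

Local Open Scope classical_set_scope.
Local Open Scope ring_scope.

(** * Calculus of smooth functions *)

(** The little-o expansion of [f] at [a] is also one of [g], since the two functions agree near [a]
    and at [a]. *)
Lemma near_eq_differentiable (R : numFieldType) (V W : normedModType R)
    (f g : V -> W) (a : V) :
  {near a, f =1 g} -> differentiable f a -> differentiable g a.
Proof.
move=> fg df.
have fga := nbhs_singleton fg.
have cdf : continuous ('d f a) by exact: diff_continuous.
have E : g \o shift a = cst (g a) + 'd f a +o_ 0 id.
  apply/eqaddoP => _/posnumP[e].
  have /eqaddoP/(_ e%:num (gt0 e)) H := diff_locally df.
  have H2 : \forall h \near (0 : V), f (h + a) = g (h + a).
    by move: fg; rewrite (near_shift 0 a) subr0.
  by apply: filterS2 H H2 => h; rewrite !fctE /= => + Eh; rewrite Eh fga.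
by apply/diff_locallyP; rewrite (diff_unique cdf E).
Qed.

Section Smooth.
Context {R : realType}.
Implicit Types V W : normedModType R.

Lemma derive_eq_on V W (A : set V) (f g : V -> W) (v : V) :
  open A -> {in A, f =1 g} -> {in A, 'D_v f =1 'D_v g}.
Proof.
move=> oA fg x; rewrite inE => Ax; apply: near_eq_derive.
have := open_nbhs_nbhs (conj oA Ax); apply: filterS => y Ay.
by rewrite fg ?inE.
Qed.

Lemma differentiable_eq_on V W (A : set V) (f g : V -> W) x :
  open A -> A x -> {in A, f =1 g} -> differentiable f x -> differentiable g x.
Proof.
move=> oA Ax fg; apply: near_eq_differentiable.
have := open_nbhs_nbhs (conj oA Ax); apply: filterS => y Ay.
by rewrite fg ?inE.
Qed.

Lemma smooth_on_differentiable V (A : set V) (F : V -> R) x :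
  smooth_on A F -> A x -> differentiable F x.
Proof. by move=> sF Ax; exact: (sF [::]). Qed.

Lemma smooth_on_derive V (A : set V) (F : V -> R) v :
  smooth_on A F -> smooth_on A ('D_v F).
Proof. by move=> sF vs x Ax; have := sF (rcons vs v) x Ax; rewrite foldr_rcons. Qed.

Lemma smooth_on_eq V (A : set V) (F G : V -> R) :
  open A -> {in A, F =1 G} -> smooth_on A F -> smooth_on A G.
Proof.
move=> oA FG sF vs x Ax; apply: (differentiable_eq_on oA Ax _ (sF vs x Ax)).
by elim: vs => //= v vs; exact: derive_eq_on.
Qed.

Lemma smooth_on_sub V (A B : set V) (F : V -> R) :
  B `<=` A -> smooth_on A F -> smooth_on B F.
Proof. by move=> BA sF vs x /BA; exact: sF. Qed.

Lemma smooth_on_local V (A : set V) (F : V -> R) :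
  (forall x, A x -> exists B, B x /\ smooth_on B F) -> smooth_on A F.
Proof. by move=> H vs x /H[B [Bx sF]]; exact: sF. Qed.

(** A device for proving smoothness of functions such as 1/|x| or the sine by differentiating only
    once: it suffices that the derivatives of the base functions [B] are polynomials in base
    functions and functions smooth on [A]. *)
Inductive generated_algebra {V} (A : set V) (B : (V -> R) -> Prop) :
    (V -> R) -> Prop :=
| gen_smooth f : smooth_on A f -> generated_algebra A B f
| gen_base f : B f -> generated_algebra A B f
| gen_add f g : generated_algebra A B f -> generated_algebra A B g ->
    generated_algebra A B (fun x => f x + g x)
| gen_mul f g : generated_algebra A B f -> generated_algebra A B g ->
    generated_algebra A B (fun x => f x * g x).

(** By the Leibniz rule the algebra is closed under directional derivatives, up to equality on the
    open set [A]. Every iterated derivative therefore agrees on [A] with a member, and members are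
    differentiable. *)
Lemma generated_algebra_smooth V (A : set V) (B : (V -> R) -> Prop) :
  open A ->
  (forall f, B f -> forall x, A x -> differentiable f x) ->
  (forall f, B f -> forall v, exists2 g,
     generated_algebra A B g & {in A, 'D_v f =1 g}) ->
  forall f, generated_algebra A B f -> smooth_on A f.
Proof.
move=> oA dB DB.
have dG f : generated_algebra A B f -> forall x, A x -> differentiable f x.
  elim=> {f}[f sf x Ax|f Bf x Ax|f g _ IHf _ IHg x Ax|f g _ IHf _ IHg x Ax].
  - exact: smooth_on_differentiable sf Ax.
  - exact: dB.
  - by apply: differentiableD; [exact: IHf|exact: IHg].
  - by apply: differentiableM; [exact: IHf|exact: IHg].
have DG f : generated_algebra A B f -> forall v, exists2 g,
    generated_algebra A B g & {in A, 'D_v f =1 g}.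
  elim=> {f}[f sf v|f Bf v|f g Gf IHf Gg IHg v|f g Gf IHf Gg IHg v].
  - by exists ('D_v f) => //; apply: gen_smooth; exact: smooth_on_derive.
  - exact: DB.
  - have [f' Gf' ff'] := IHf v; have [g' Gg' gg'] := IHg v.
    exists (fun x => f' x + g' x); first exact: gen_add.
    move=> x xA; rewrite -ff' // -gg' //; rewrite inE in xA.
    by apply: deriveD; apply: diff_derivable; exact: dG.
  - have [f' Gf' ff'] := IHf v; have [g' Gg' gg'] := IHg v.
    exists (fun x => f x * g' x + g x * f' x).
      by apply: gen_add; apply: gen_mul.
    move=> x xA; rewrite -ff' // -gg' //; rewrite inE in xA.
    by apply: deriveM; apply: diff_derivable; exact: dG.
move=> f Gf vs x Ax.
suff [g Gg fg] : exists2 g, generated_algebra A B g &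
    {in A, g =1 foldr (fun v G => 'D_v G) f vs}.
  by apply: (differentiable_eq_on oA Ax fg); apply: dG.
elim: vs => [|v vs [g Gg fg]] /=; first by exists f.
have [g' Gg' gg'] := DG _ Gg v; exists g' => // y yA.
by rewrite -gg' //; exact: (derive_eq_on v oA fg).
Qed.

Lemma smooth_on_cst V (A : set V) (a : R) : smooth_on A (cst a).
Proof.
suff H vs : exists b : R, foldr (fun v G => 'D_v G) (cst a : V -> R) vs = cst b.
  by move=> vs x _; have [b ->] := H vs.
elim: vs => [|v vs [b /= ->]]; first by exists a.
by exists 0; apply/funext => x; rewrite derive_cst.
Qed.

Lemma smooth_on_add V (A : set V) (f g : V -> R) : open A ->
  smooth_on A f -> smooth_on A g -> smooth_on A (fun x => f x + g x).
Proof.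
move=> oA sf sg.
apply: (@generated_algebra_smooth _ A (fun=> False)) => //.
by apply: gen_add; exact: gen_smooth.
Qed.

Lemma smooth_on_mul V (A : set V) (f g : V -> R) : open A ->
  smooth_on A f -> smooth_on A g -> smooth_on A (fun x => f x * g x).
Proof.
move=> oA sf sg.
apply: (@generated_algebra_smooth _ A (fun=> False)) => //.
by apply: gen_mul; exact: gen_smooth.
Qed.

Lemma smooth_on_exp V (A : set V) (f : V -> R) k : open A ->
  smooth_on A f -> smooth_on A (fun x => f x ^+ k).
Proof.
move=> oA sf; elim: k => [|k IH]; first exact: smooth_on_cst.
have -> : (fun x => f x ^+ k.+1) = (fun x => f x * f x ^+ k).
  by apply/funext => x; rewrite exprS.
exact: smooth_on_mul.
Qed.

Lemma smooth_on_sum V (A : set V) I (r : seq I) (f : I -> V -> R) : open A ->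
  (forall i, smooth_on A (f i)) -> smooth_on A (fun x => \sum_(i <- r) f i x).
Proof.
move=> oA sf; elim: r => [|i r IH].
  by apply: (smooth_on_eq oA _ (smooth_on_cst 0)) => x _; rewrite big_nil.
have := smooth_on_add oA (sf i) IH; apply: smooth_on_eq => // x _.
by rewrite big_cons.
Qed.

Lemma smooth_on_linear V (A : set V) (f : {linear V -> R}) :
  continuous f -> smooth_on A f.
Proof.
move=> cf [|v vs] x Ax; first exact: linear_differentiable.
suff [b ->] : exists b : R, foldr (fun v G => 'D_v G) (f : V -> R) (v :: vs) = cst b.
  by [].
elim: vs v => [|w vs IH] v.
  exists (f v); apply/funext => y /=.
  by rewrite deriveE ?diff_lin //; exact: linear_differentiable.
have [b /= bE] := IH w; rewrite /= bE; exists 0.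
by apply/funext => y; rewrite derive_cst.
Qed.

Lemma smooth_on_scalar V (A : set V) (F : V -> R) :
  scalar F -> continuous F -> smooth_on A F.
Proof.
move=> lF cF; pose lFM := GRing.isLinear.Build R V R *%R F lF.
by pose f : {linear V -> R} := HB.pack F lFM; exact: (@smooth_on_linear _ A f).
Qed.

Lemma is_diff_sum_scale V W I (r : seq I) (c : I -> V -> R) (e : I -> W) x :
  (forall i, differentiable (c i) x) ->
  is_diff x (fun y => \sum_(i <- r) c i y *: e i)
    (fun v => \sum_(i <- r) 'd (c i) x v *: e i).
Proof.
move=> dc; elim: r => [|i r IH].
  have -> : (fun y => \sum_(i <- [::]) c i y *: e i) = cst 0.
    by apply/funext => y; rewrite big_nil.
  apply: is_diff_eq; apply/funext => v; by rewrite big_nil.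
have -> : (fun y => \sum_(j <- i :: r) c j y *: e j) =
    (fun y => c i y *: e i) + (fun y => \sum_(j <- r) c j y *: e j).
  by apply/funext => y; rewrite big_cons.
have D : is_diff x (fun y => c i y *: e i) (fun v => 'd (c i) x v *: e i).
  by apply: DiffDef; [exact: differentiableZl|rewrite diffZl].
apply: is_diff_eq; apply/funext => v; by rewrite big_cons.
Qed.

(** [smooth_on] concerns scalar functions, so the inner map g enters through its coefficients c_i
    along vectors e_i. The base consists of all G o g with G smooth on [B]; the chain rule D_v (G o
    g) = sum_i D_v c_i . (D_(e_i) G o g) stays in the algebra. *)
Lemma smooth_on_comp V W (A : set V) (B : set W) I (r : seq I)
    (c : I -> V -> R) (e : I -> W) (F : W -> R) :
  open A -> (forall i, smooth_on A (c i)) -> smooth_on B F ->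
  (forall x, A x -> B (\sum_(i <- r) c i x *: e i)) ->
  smooth_on A (fun x => F (\sum_(i <- r) c i x *: e i)).
Proof.
move=> oA sc sF AB.
pose g x := \sum_(i <- r) c i x *: e i.
have dc x i : A x -> differentiable (c i) x.
  by move=> Ax; exact: smooth_on_differentiable (sc i) Ax.
have dg x : A x -> is_diff x g (fun v => \sum_(i <- r) 'd (c i) x v *: e i).
  by move=> Ax; apply: is_diff_sum_scale => i; exact: dc.
apply: (@generated_algebra_smooth _ A
  (fun f => exists2 G, smooth_on B G & f = G \o g)) => //; last first.
- by apply: gen_base; exists F.
- move=> _ [G sG ->] v.
  exists (fun x => \sum_(i <- r) 'D_v (c i) x * ('D_(e i) G \o g) x).
    elim: {1}r => [|i s IH].
      apply: gen_smooth; apply: (smooth_on_eq oA _ (smooth_on_cst 0)) => x _.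
      by rewrite big_nil.
    have -> : (fun x => \sum_(j <- i :: s) 'D_v (c j) x * ('D_(e j) G \o g) x) =
        (fun x => 'D_v (c i) x * ('D_(e i) G \o g) x +
          \sum_(j <- s) 'D_v (c j) x * ('D_(e j) G \o g) x).
      by apply/funext => x; rewrite big_cons.
    apply: gen_add => //; apply: gen_mul.
      by apply: gen_smooth; exact: smooth_on_derive.
    by apply: gen_base; exists ('D_(e i) G) => //; exact: smooth_on_derive.
  move=> x; rewrite inE => Ax.
  have [dgx Dg] := dg x Ax.
  have dG : differentiable G (g x).
    exact: smooth_on_differentiable sG (AB _ Ax).
  rewrite deriveE; last exact: differentiable_comp.
  rewrite diff_comp // /= Dg linear_sum; apply: eq_bigr => i _.
  by rewrite linearZ /= -!deriveE //; exact: dc.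
- move=> _ [G sG ->] x Ax; apply: differentiable_comp.
    by have [] := dg x Ax.
  exact: smooth_on_differentiable sG (AB _ Ax).
Qed.

End Smooth.

(** * The Euclidean norm *)

Section Sphere.
Context {R : realType}.

Definition dotp m (x y : 'rV[R]_m) : R := \sum_i x 0 i * y 0 i.

Lemma dotpC m (x y : 'rV[R]_m) : dotp x y = dotp y x.
Proof. by apply: eq_bigr => i _; rewrite mulrC. Qed.

Lemma dotp_ge0 m (x : 'rV[R]_m) : 0 <= dotp x x.
Proof. by apply: sumr_ge0 => i _; rewrite -expr2 sqr_ge0. Qed.

Lemma dotpxx_eq0 m (x : 'rV[R]_m) : (dotp x x == 0) = (x == 0).
Proof.
apply/eqP/eqP => [x0|->]; last by rewrite /dotp big1 // => i _; rewrite mxE mul0r.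
apply/rowP => i; rewrite mxE.
have H : forall j, true -> 0 <= x 0 j * x 0 j by move=> j _; rewrite -expr2 sqr_ge0.
by apply/eqP; rewrite -sqrf_eq0 expr2 (psumr_eq0P H x0).
Qed.

Lemma eucl_normE m (x : 'rV[R]_m) : eucl_norm x = Num.sqrt (dotp x x).
Proof. by []. Qed.

Lemma eucl_norm_sqr m (x : 'rV[R]_m) : eucl_norm x ^+ 2 = dotp x x.
Proof. by rewrite eucl_normE sqr_sqrtr // dotp_ge0. Qed.

Lemma eucl_norm_ge0 m (x : 'rV[R]_m) : 0 <= eucl_norm x.
Proof. exact: sqrtr_ge0. Qed.

Lemma eucl_norm_eq0 m (x : 'rV[R]_m) : (eucl_norm x == 0) = (x == 0).
Proof. by rewrite -sqrf_eq0 eucl_norm_sqr dotpxx_eq0. Qed.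

Lemma eucl_norm_gt0 m (x : 'rV[R]_m) : (0 < eucl_norm x) = (x != 0).
Proof. by rewrite lt0r eucl_norm_eq0 eucl_norm_ge0 andbT. Qed.

Lemma dotpZ m (a b : R) (x y : 'rV[R]_m) : dotp (a *: x) (b *: y) = a * b * dotp x y.
Proof. by rewrite /dotp mulr_sumr; apply: eq_bigr => i _; rewrite !mxE; ring. Qed.

Lemma eucl_normZ m (a : R) (x : 'rV[R]_m) : 0 <= a ->
  eucl_norm (a *: x) = a * eucl_norm x.
Proof.
move=> a0; rewrite !eucl_normE dotpZ sqrtrM ?mulr_ge0 //.
by rewrite -expr2 sqrtr_sqr ger0_norm.
Qed.

Lemma coord_sqr_le_dotp m (x : 'rV[R]_m) j : x 0 j ^+ 2 <= dotp x x.
Proof.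
rewrite /dotp (bigD1 j) //= -expr2 lerDl; apply: sumr_ge0 => k _.
by rewrite -expr2 sqr_ge0.
Qed.

Lemma norm_coord_le m (x : 'rV[R]_m) j : `|x 0 j| <= eucl_norm x.
Proof.
rewrite -(@ler_pXn2r _ 2) ?nnegrE ?eucl_norm_ge0 // real_normK ?num_real //.
by rewrite eucl_norm_sqr coord_sqr_le_dotp.
Qed.

Variable n : nat.
Local Notation V := ('rV[R]_n.+1).
Implicit Types (x y : V).

Lemma retractE x : x != 0 -> val (retract x) = (eucl_norm x)^-1 *: x.
Proof.
move=> x0; rewrite /retract insubdK // unfold_in /=.
by rewrite eucl_normZ ?invr_ge0 ?eucl_norm_ge0 // mulVf // eucl_norm_eq0.
Qed.

Lemma retract_eq x y (a : R) : 0 < a -> x != 0 -> y = a *: x -> retract y = retract x.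
Proof.
move=> a0 x0 ->; have ax0 : a *: x != 0 by rewrite scaler_eq0 negb_or gt_eqF.
apply: val_inj; rewrite !retractE // eucl_normZ ?ltW // scalerA invfM mulrAC.
by rewrite mulVf ?mul1r // gt_eqF.
Qed.

Lemma sphere_neq0 (x : sphere R n) : val x != 0.
Proof.
by rewrite -eucl_norm_eq0 (eqP (valP x)) oner_eq0.
Qed.

Definition punctured : set V := [set x | x != 0].
Definition punctured_time : set (V * R) := [set p | p.1 != 0].

Lemma open_punctured : open punctured.
Proof.
rewrite (_ : punctured = ~` [set 0]); last first.
  by apply/seteqP; split=> x /eqP.
apply: closed_openC; exact/accessible_closed_set1/hausdorff_accessible/norm_hausdorff.
Qed.

Lemma open_punctured_time : open punctured_time.
Proof.
rewrite (_ : punctured_time = fst @^-1` punctured) //.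
apply: open_comp open_punctured => p _; exact: cvg_fst.
Qed.


Lemma smooth_on_coord (A : set V) i : smooth_on A (fun x => x 0 i).
Proof.
by apply: smooth_on_scalar; [move=> a x y; rewrite !mxE|exact: coord_continuous].
Qed.

Lemma smooth_on_coord_time (A : set (V * R)) i : smooth_on A (fun p => p.1 0 i).
Proof.
apply: smooth_on_scalar; first by move=> a x y; rewrite !mxE.
by move=> p; apply: (continuous_comp (g := fun x : V => x 0 i));
  [exact: cvg_fst|exact: coord_continuous].
Qed.

Lemma smooth_on_time (A : set (V * R)) : smooth_on A (fun p => p.2).
Proof. by apply: smooth_on_scalar => // p; exact: cvg_snd. Qed.

Lemma smooth_on_dotp (A : set V) y : open A -> smooth_on A (dotp y).
Proof.
move=> oA; apply: smooth_on_sum => // i.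
by apply: smooth_on_mul => //; [exact: smooth_on_cst|exact: smooth_on_coord].
Qed.

Lemma derive_coord v x i : 'D_v (fun y : V => y 0 i) x = v 0 i.
Proof.
rewrite deriveE; last exact: differentiable_coord.
have @f : {linear V -> R}.
  by exists (fun N : V => N 0 i); do 2![eexists]; do ?[constructor];
     rewrite ?mxE// => ? *; rewrite ?mxE//; move=> ?; rewrite !mxE.
rewrite (_ : (fun _ => _) = f) // diff_lin //; exact: coord_continuous.
Qed.

Lemma derive_dotpxx v x : 'D_v (fun y : V => dotp y y) x = 2 * dotp x v.
Proof.
rewrite (_ : (fun y => _) = (\sum_i (fun y : V => y 0 i * y 0 i))); last first.
  by apply/funext => y; rewrite fct_sumE.
have dc i : derivable (fun y : V => y 0 i) x v.
  by apply: diff_derivable; exact: differentiable_coord.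
rewrite derive_sum; last by move=> i; exact: derivableM.
rewrite mulr_sumr; apply: eq_bigr => i _.
by rewrite deriveM // derive_coord /GRing.scale /=; ring.
Qed.

Lemma smooth_on_dotpxx (A : set V) : open A -> smooth_on A (fun x : V => dotp x x).
Proof.
move=> oA; apply: smooth_on_sum => // i.
by apply: smooth_on_mul => //; exact: smooth_on_coord.
Qed.

Lemma is_diff_eucl_norm x : x != 0 ->
  is_diff x (fun y : V => eucl_norm y) (fun v => dotp x v / eucl_norm x).
Proof.
move=> x0.
have dx0 : 0 < dotp x x by rewrite lt0r dotpxx_eq0 x0 dotp_ge0.
have := is_derive1_sqrt dx0.
move=> [/derivable1_diffP ds Ds].
have dd : differentiable (fun y : V => dotp y y) x.
  apply: (smooth_on_differentiable (A := setT)) => //.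
  by apply: smooth_on_dotpxx; exact: openT.
rewrite (_ : (fun y => _) = Num.sqrt \o (fun y : V => dotp y y)) //.
apply: DiffDef; first exact: differentiable_comp.
rewrite diff_comp //; apply/funext => v /=.
rewrite -(deriveE v dd) derive_dotpxx.
rewrite -[X in 'd _ _ X]mulr1 linearZ /= -deriveE // Ds -eucl_normE.
have := x0; rewrite -eucl_norm_eq0 /GRing.scale /= => h; field; exact: h.
Qed.

(** One base function is enough, because D_v (1/|x|) = - <v, x> / |x|^3 is a linear function times a
    power of 1/|x|. *)
Lemma smooth_on_inv_norm : smooth_on punctured (fun x : V => (eucl_norm x)^-1).
Proof.
have dN x : x != 0 -> differentiable (fun x : V => (eucl_norm x)^-1) x.
  move=> x0; apply: (@differentiableV _ _ (fun y : V => eucl_norm y));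
    last by rewrite eucl_norm_eq0.
  by have [] := is_diff_eucl_norm x0.
apply: (@generated_algebra_smooth _ _ _ (fun F => F = fun x : V => (eucl_norm x)^-1)).
- exact: open_punctured.
- by move=> _ -> x x0; exact: dN.
- move=> _ -> v; exists (fun x => (-1) * (dotp v x *
      ((eucl_norm x)^-1 * ((eucl_norm x)^-1 * (eucl_norm x)^-1)))).
    apply: gen_mul; first by apply: gen_smooth; exact: smooth_on_cst.
    apply: gen_mul.
      by apply: gen_smooth; apply: smooth_on_dotp; exact: open_punctured.
    by apply: gen_mul; [exact: gen_base|apply: gen_mul; exact: gen_base].
  move=> x; rewrite inE => x0.
  have [dx Dx] := is_diff_eucl_norm x0.
  rewrite deriveE; last exact: dN.
  rewrite (@diffV _ _ (fun y : V => eucl_norm y)) ?eucl_norm_eq0 //= Dx dotpC.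
  have := x0; rewrite /punctured /= -eucl_norm_eq0 /GRing.scale /= => h; field; exact: h.
- exact: gen_base.
Qed.

(** Away from 0, |x| is the product of |x|^2 and 1/|x|. *)
Lemma smooth_on_norm : smooth_on punctured (fun x : V => eucl_norm x).
Proof.
apply: smooth_on_eq (smooth_on_mul _ (smooth_on_dotpxx _) smooth_on_inv_norm);
  try exact: open_punctured.
move=> x; rewrite inE -eucl_norm_sqr /punctured /= -eucl_norm_eq0 => x0.
by rewrite expr2 mulfK.
Qed.

End Sphere.

Arguments punctured {R n}.
Arguments punctured_time {R n}.

(** * Smooth functions on the sphere *)

Section SmoothSphere.
Context {R : realType} {n : nat}.
Local Notation V := ('rV[R]_n.+1).
Local Notation S := (sphere R n).
Implicit Types (f g : S -> R) (u : S -> R -> R).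

Lemma smooth_on_comp_row (W : normedModType R) (A : set W) (B : set V)
    (X : W -> V) (F : V -> R) :
  open A -> (forall i, smooth_on A (fun w => X w 0 i)) -> smooth_on B F ->
  (forall w, A w -> B (X w)) -> smooth_on A (F \o X).
Proof.
move=> oA sX sF AB.
have E w : X w = \sum_j X w 0 j *: delta_mx 0 j by exact: row_sum_delta.
rewrite (_ : F \o X = fun w => F (\sum_j X w 0 j *: delta_mx 0 j)); last first.
  by apply/funext => w; rewrite -E.
by apply: (smooth_on_comp oA sX sF) => w Aw; rewrite -E; exact: AB.
Qed.

Lemma smooth_on_comp_pair (W : normedModType R) (A : set W) (B : set (V * R))
    (X : W -> V) (T : W -> R) (F : V * R -> R) :
  open A -> (forall i, smooth_on A (fun w => X w 0 i)) -> smooth_on A T ->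
  smooth_on B F -> (forall w, A w -> B (X w, T w)) ->
  smooth_on A (fun w => F (X w, T w)).
Proof.
move=> oA sX sT sF AB.
(* [None] stands for the time coordinate and [Some i] for the i-th space coordinate. *)
pose c (o : option 'I_n.+1) w := if o is Some i then X w 0 i else T w.
pose e (o : option 'I_n.+1) : V * R :=
  if o is Some i then (delta_mx 0 i, 0) else (0, 1).
have E w : (X w, T w) = \sum_(o <- None :: map Some (enum 'I_n.+1)) c o w *: e o.
  rewrite big_cons big_map big_enum /= [X w in LHS]row_sum_delta.
  have H1 : (0, T w) = T w *: ((0, 1) : V * R).
    by rewrite [RHS]surjective_pairing /= scaler0 [_ *: 1]mulr1.
  have H2 (r : seq 'I_n.+1) : (\sum_(i <- r) X w 0 i *: delta_mx 0 i, 0) =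
      \sum_(i <- r) X w 0 i *: ((delta_mx 0 i, 0) : V * R).
    elim: r => [|i r IH]; first by rewrite !big_nil.
    rewrite !big_cons -IH; congr pair; rewrite /=.
    by rewrite [_ *: (0 : R)]mulr0 addr0.
  rewrite -H1 -H2; congr pair; rewrite /=; first by rewrite add0r.
  by rewrite addr0.
rewrite (_ : (fun w => _) =
    (fun w => F (\sum_(o <- None :: map Some (enum 'I_n.+1)) c o w *: e o))); last first.
  by apply/funext => w; rewrite -E.
apply: (smooth_on_comp oA _ sF) => [[i|]|w Aw]; first exact: sX.
  exact: sT.
by rewrite -E; exact: AB.
Qed.

Lemma smooth_on_comp_real (W : normedModType R) (A : set W) (B : set R)
    (T F : _ -> R) :
  open A -> smooth_on A T -> smooth_on B F ->
  (forall w, A w -> B (T w)) -> smooth_on A (F \o T).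
Proof.
move=> oA sT sF AB.
have E w : T w = \sum_(i <- [:: tt]) T w *: (1 : R).
  by rewrite big_seq1 /GRing.scale /= mulr1.
rewrite (_ : F \o T = fun w => F (\sum_(i <- [:: tt]) T w *: (1 : R))); last first.
  by apply/funext => w; rewrite -E.
by apply: (smooth_on_comp oA _ sF) => // w Aw; rewrite -E; exact: AB.
Qed.

(** The extension constant on rays is the function that [tderive] differentiates; it lives on an
    open set of a vector space, where [smooth_on] applies. *)
Definition smooth_sphere f := smooth_on punctured (f \o @retract R n).

Definition smooth_time u :=
  smooth_on punctured_time (fun p => u (retract p.1) p.2).

Lemma smooth_on_retract_coord i :
  smooth_on punctured (fun x : V => val (retract x) 0 i).
Proof.
apply: smooth_on_eq
  (smooth_on_mul _ (@smooth_on_inv_norm R n) (@smooth_on_coord R n _ i));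
  try exact: open_punctured.
by move=> x; rewrite inE => x0; rewrite retractE // mxE.
Qed.

Lemma smooth_on_retract_coord_time i :
  smooth_on punctured_time (fun p : V * R => val (retract p.1) 0 i).
Proof.
apply: (smooth_on_comp_row (A := punctured_time) (B := punctured) (X := fst)
  (F := fun x => val (retract x) 0 i)).
- exact: open_punctured_time.
- by move=> j; exact: smooth_on_coord_time.
- exact: smooth_on_retract_coord.
- by [].
Qed.

(** Given local extensions F, the homogeneous extension is locally F(x/|x|, t), hence smooth by
    composition. Conversely it is itself an extension, defined off the origin. *)
Lemma smooth_sphere_timeP u : smooth_sphere_time u <-> smooth_time u.
Proof.
split=> [su|su x t]; last first.
  exists punctured_time, (fun p => u (retract p.1) p.2); split => //.
    by split; [exact: open_punctured_time|exact: sphere_neq0].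
  by move=> y s _ /=; rewrite retract_val.
apply: smooth_on_local => -[x0 t0] /= x0N0.
have [A [F [[oA Ax] sF FE]]] := su (retract x0) t0.
pose g (p : V * R) : V * R := (val (retract p.1), p.2).
(* The points whose radial projection falls into the domain of the local extension. *)
pose B := punctured_time `&` g @^-1` A.
exists B; split => //.
have oB : open B.
  rewrite openE => p [pN0 Agp].
  apply: filterI; first exact: (open_nbhs_nbhs (conj (@open_punctured_time R n) pN0)).
  suff : {for p, continuous g} by apply; exact: (open_nbhs_nbhs (conj oA Agp)).
  have c1 : (fun q : V * R => val (retract q.1)) @ p --> val (retract p.1).
    apply: (@cvg_trans _ ((fun q : V * R => (eucl_norm q.1)^-1 *: q.1) @ p)).
      apply: near_eq_cvg.
      have := open_nbhs_nbhs (conj (@open_punctured_time R n) pN0).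
      by apply: filterS => q q0; rewrite retractE.
    rewrite retractE //.
    have c2 : (fun q : V * R => (eucl_norm q.1)^-1) @ p --> (eucl_norm p.1)^-1.
      apply: (cvg_comp fst (fun x : V => (eucl_norm x)^-1) cvg_fst).
      exact: differentiable_continuous
        (smooth_on_differentiable (@smooth_on_inv_norm R n) pN0).
    exact: (cvgZ c2 cvg_fst).
  exact: (cvg_pair c1 cvg_snd).
apply: (smooth_on_eq oB (F := fun p => F (val (retract p.1), p.2))).
  by move=> p; rewrite inE => -[pN0 Ap]; exact: FE.
apply: (smooth_on_comp_pair oB _ _ sF) => [i||p []//].
  by apply: smooth_on_sub (smooth_on_retract_coord_time i) => p [].
exact: smooth_on_time.
Qed.

Lemma smooth_time_slice u t : smooth_time u -> smooth_sphere (u ^~ t).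
Proof.
move=> su; apply: (smooth_on_comp_pair _ _ _ su (X := id) (T := cst t)) => //.
- exact: open_punctured.
- by move=> i; exact: smooth_on_coord.
- exact: smooth_on_cst.
Qed.

Lemma smooth_time_mul f (h : R -> R) :
  smooth_sphere f -> smooth_on setT h -> smooth_time (fun x t => f x * h t).
Proof.
move=> sf sh; apply: smooth_on_mul; first exact: open_punctured_time.
  apply: (smooth_on_comp_row (A := punctured_time) (B := punctured) (X := fst)
    (F := f \o @retract R n)) => //.
    exact: open_punctured_time.
  by move=> i; exact: smooth_on_coord_time.
apply: (smooth_on_comp_real (A := punctured_time) (B := setT) (T := snd)) => //.
  exact: open_punctured_time.
exact: smooth_on_time.
Qed.

Lemma smooth_time_add u v : smooth_time u -> smooth_time v ->
  smooth_time (fun x t => u x t + v x t).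
Proof. by apply: smooth_on_add; exact: open_punctured_time. Qed.

Lemma smooth_sphere_add f g : smooth_sphere f -> smooth_sphere g ->
  smooth_sphere (fun x => f x + g x).
Proof. by apply: smooth_on_add; exact: open_punctured. Qed.

Lemma smooth_sphere_mul f g : smooth_sphere f -> smooth_sphere g ->
  smooth_sphere (fun x => f x * g x).
Proof. by apply: smooth_on_mul; exact: open_punctured. Qed.

Lemma smooth_sphere_cst (a : R) : smooth_sphere (cst a).
Proof. exact: smooth_on_cst. Qed.

Lemma smooth_sphere_coord i : smooth_sphere (fun x => val x 0 i).
Proof. exact: smooth_on_retract_coord. Qed.

Lemma smooth_sphere_exp f k : smooth_sphere f -> smooth_sphere (fun x => f x ^+ k).
Proof. by apply: smooth_on_exp; exact: open_punctured. Qed.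

Lemma smooth_sphere_sum I (r : seq I) (f : I -> S -> R) :
  (forall i, smooth_sphere (f i)) -> smooth_sphere (fun x => \sum_(i <- r) f i x).
Proof. by apply: smooth_on_sum; exact: open_punctured. Qed.

Lemma smooth_sphere_differentiable f (x : S) :
  smooth_sphere f -> differentiable (f \o @retract R n) (val x).
Proof. by move=> sf; apply: smooth_on_differentiable sf _; exact: sphere_neq0. Qed.

(** The operator T_i = |x| d/dx_i at points with |x| = 1. *)
Definition dcoord (i : 'I_n.+1) f : S -> R := tderive f (delta_mx 0 i).

Lemma dcoordE i f x : dcoord i f x = 'D_(delta_mx 0 i) (f \o @retract R n) (val x).
Proof. by []. Qed.

Lemma laplace_beltramiE f x : laplace_beltrami f x = \sum_i dcoord i (dcoord i f) x.
Proof.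
rewrite /laplace_beltrami /divergence; apply: eq_bigr => i _.
rewrite (_ : (fun y => grad f y 0 i) = dcoord i f) //.
by apply/funext => y; rewrite mxE.
Qed.

Lemma dcoordD i f g x : smooth_sphere f -> smooth_sphere g ->
  dcoord i (fun y => f y + g y) x = dcoord i f x + dcoord i g x.
Proof.
move=> sf sg; rewrite !dcoordE.
by apply: (@deriveD _ _ _ (f \o @retract R n) (g \o @retract R n));
  apply: diff_derivable; exact: smooth_sphere_differentiable.
Qed.

Lemma dcoordM i f g x : smooth_sphere f -> smooth_sphere g ->
  dcoord i (fun y => f y * g y) x = f x * dcoord i g x + g x * dcoord i f x.
Proof.
move=> sf sg; rewrite !dcoordE -[in f x](retract_val x) -[in g x](retract_val x).
by apply: (@deriveM _ _ (f \o @retract R n) (g \o @retract R n));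
  apply: diff_derivable; exact: smooth_sphere_differentiable.
Qed.

Lemma dcoord_cst i (a : R) x : dcoord i (cst a) x = 0.
Proof. by rewrite dcoordE -[RHS](derive_cst (V := V) a (val x) (delta_mx 0 i)). Qed.

Lemma dcoordZ i (a : R) f x : smooth_sphere f ->
  dcoord i (fun y => a * f y) x = a * dcoord i f x.
Proof.
move=> sf; rewrite (@dcoordM i (cst a)) ?dcoord_cst ?mulr0 ?addr0 //.
exact: smooth_sphere_cst.
Qed.

Lemma dcoord_sum i I (r : seq I) (f : I -> S -> R) x :
  (forall j, smooth_sphere (f j)) ->
  dcoord i (fun y => \sum_(j <- r) f j y) x = \sum_(j <- r) dcoord i (f j) x.
Proof.
move=> sf; elim: r => [|j r IH].
  rewrite big_nil -[RHS](dcoord_cst i 0 x); congr dcoord.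
  by apply/funext => y; rewrite big_nil.
rewrite big_cons -IH -dcoordD //; last exact: smooth_sphere_sum.
by congr dcoord; apply/funext => y; rewrite big_cons.
Qed.

Lemma dcoord_exp i f k x : smooth_sphere f ->
  dcoord i (fun y => f y ^+ k) x = k%:R * f x ^+ k.-1 * dcoord i f x.
Proof.
move=> sf; elim: k => [|k IH]; first by rewrite mul0r mul0r -[RHS](dcoord_cst i 1 x).
rewrite (_ : (fun y => _) = (fun y => f y * f y ^+ k)); last first.
  by apply/funext => y; rewrite exprS.
rewrite dcoordM // ?IH; last exact: smooth_sphere_exp.
case: k {IH} => [|k] /=; first by rewrite expr0; ring.
by rewrite !exprS -[k.+2]addn1 -[k.+1]addn1 !natrD; ring.
Qed.

(** These are the entries of the orthogonal projection to the tangent space, obtained by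
    differentiating x_j / |x| where |x| = 1. *)
Lemma dcoord_coord i j (x : S) :
  dcoord i (fun y => val y 0 j) x = (i == j)%:R - val x 0 i * val x 0 j.
Proof.
rewrite dcoordE.
have xN0 := sphere_neq0 x.
have x1 : eucl_norm (val x) = 1 := eqP (valP x).
rewrite (@derive_eq_on _ _ _ punctured _
    ((fun y : V => y 0 j) * (fun y : V => (eucl_norm y)^-1))) ?inE //; last 2 first.
- exact: open_punctured.
- by move=> y; rewrite inE => y0 /=; rewrite retractE // mxE mulrC.
have dc : differentiable (fun y : V => y 0 j) (val x) by exact: differentiable_coord.
have [dN DN] := is_diff_eucl_norm xN0.
have dI : differentiable (fun y : V => (eucl_norm y)^-1) (val x).
  by apply: smooth_on_differentiable (@smooth_on_inv_norm R n) _.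
rewrite deriveM; try exact: diff_derivable.
rewrite derive_coord deriveE //.
rewrite (@diffV _ _ (fun y : V => eucl_norm y)) ?eucl_norm_eq0 //= DN x1.
rewrite /GRing.scale /= !invr1 expr1n invr1 mulr1 mul1r mxE eqxx /=.
rewrite /dotp (bigD1 i) //= big1 ?addr0 => [|k /negbTE ki].
  by rewrite mxE !eqxx /= eq_sym; ring.
by rewrite mxE ki andbF mulr0.
Qed.

(** A function constant on rays has partial derivatives homogeneous of degree -1, so moving from x
    to x/|x| costs a factor |x|. *)
Lemma dcoord_ext i f (x : V) : smooth_sphere f -> x != 0 ->
  dcoord i f (retract x) = eucl_norm x * 'D_(delta_mx 0 i) (f \o @retract R n) x.
Proof.
move=> sf x0; rewrite dcoordE retractE //.
set W := f \o _; set v := delta_mx 0 i.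
have N0 : 0 < eucl_norm x by rewrite eucl_norm_gt0.
set c := (eucl_norm x)^-1.
have c0 : 0 < c by rewrite invr_gt0.
have cx0 : c *: x != 0 by rewrite scaler_eq0 negb_or x0 gt_eqF.
have dW : differentiable W (c *: x) by exact: smooth_on_differentiable sf cx0.
have -> : 'D_v W x = 'D_v (W \o ( *:%R c)) x.
  apply: (@derive_eq_on _ _ _ punctured); rewrite ?inE //; first exact: open_punctured.
  by move=> y; rewrite inE => y0 /=; rewrite /W /= (retract_eq c0 y0 erefl).
have ds : is_diff x ( *:%R c : V -> V) ( *:%R c) by exact: is_diff_scaler.
have [ds1 ds2] := ds.
rewrite [in RHS]deriveE; last exact: differentiable_comp.
rewrite diff_comp //= ds2 linearZ /= -deriveE //.
rewrite /GRing.scale /= mulrA mulfV ?mul1r //.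
by rewrite gt_eqF.
Qed.

Lemma smooth_sphere_dcoord i f : smooth_sphere f -> smooth_sphere (dcoord i f).
Proof.
move=> sf; apply: smooth_on_eq
  (smooth_on_mul _ (@smooth_on_norm R n) (smooth_on_derive (delta_mx 0 i) sf));
  try exact: open_punctured.
by move=> x; rewrite inE => x0; rewrite /= dcoord_ext.
Qed.

Lemma smooth_sphere_laplace f : smooth_sphere f -> smooth_sphere (laplace_beltrami f).
Proof.
move=> sf; rewrite (_ : laplace_beltrami f =
    fun x => \sum_i dcoord i (dcoord i f) x).
  by apply: smooth_sphere_sum => i; do 2 apply: smooth_sphere_dcoord.
by apply/funext => x; exact: laplace_beltramiE.
Qed.

(** The gradient is tangent: the sum is the radial derivative of an extension that is constant on
    rays (Euler's relation in degree 0). *)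
Lemma sum_coord_dcoord f (x : S) : smooth_sphere f ->
  \sum_i val x 0 i * dcoord i f x = 0.
Proof.
move=> sf; have dW := smooth_sphere_differentiable x sf.
rewrite (eq_bigr (fun i => 'd (f \o @retract R n) (val x) (val x 0 i *: delta_mx 0 i)));
  last by move=> i _; rewrite linearZ /= dcoordE deriveE.
rewrite -linear_sum -row_sum_delta -deriveE //.
rewrite /derive; apply: cvg_lim => //.
apply: (@cvg_trans _ (cst (0 : R) @ (0 : R)^')); last exact: cvg_cst.
apply: near_eq_cvg; near=> h.
rewrite /= (_ : h *: val x + val x = (h + 1) *: val x); last first.
  by rewrite scalerDl scale1r.
(* For h > -1 the point (h + 1) x stays on the ray of x, so the difference quotient is 0. *)
have h1 : 0 < h + 1.
  suff : - 1 < h by lra.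
  near: h; apply: nbhs_dnbhs; apply: lt_nbhsr; lra.
by rewrite (retract_eq h1 (sphere_neq0 x) erefl) subrr scaler0.
Unshelve. all: by end_near. Qed.

End SmoothSphere.

(** * Time derivatives and waves *)

Section TimeDerivative.
Context {R : realType} {n : nat}.
Local Notation V := ('rV[R]_n.+1).
Local Notation S := (sphere R n).
Implicit Types (f g : S -> R) (u v : S -> R -> R).

Definition dtime u : S -> R -> R := fun x => derive1 (u x).

(** Both sides are limits of the same difference quotients. Time derivatives thus inherit smoothness
    from directional derivatives on the product space. *)
Lemma derive_time u (y : V) (t : R) :
  'D_((0, 1) : V * R) (fun p => u (retract p.1) p.2) (y, t) =
  dtime u (retract y) t.
Proof.
rewrite /dtime derive1E.
have E : (fun h : R => h^-1 *: (((fun p => u (retract p.1) p.2) \o shift (y, t))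
      (h *: ((0, 1) : V * R)) - u (retract y) t)) =
    (fun h : R => h^-1 *: ((u (retract y) \o shift t) (h *: 1) - u (retract y) t)).
  by apply/funext => h /=; rewrite scaler0 add0r.
exact: (congr1 (fun F : R -> R => lim (F @ 0^')) E).
Qed.

Lemma smooth_time_dtime u : smooth_time u -> smooth_time (dtime u).
Proof.
move=> su; apply: (smooth_on_eq (@open_punctured_time R n) _
  (smooth_on_derive ((0, 1) : V * R) su)).
by move=> -[y t] _; exact: derive_time.
Qed.

Lemma smooth_time_at u (x : S) : smooth_time u -> smooth_on setT (u x).
Proof.
move=> su; have H : smooth_on setT (fun t => u (retract (val x)) t).
  apply: (smooth_on_comp_pair _ _ _ su (X := cst (val x)) (T := id)).
  - exact: openT.
  - by move=> i; exact: smooth_on_cst.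
  - by apply: smooth_on_scalar => // t; exact: cvg_id.
  - by move=> t _; exact: sphere_neq0.
by move: H; rewrite retract_val.
Qed.

Lemma is_derive_dtime u (x : S) (t : R) : smooth_time u ->
  is_derive t 1 (u x) (dtime u x t).
Proof.
move=> su; apply: DeriveDef; last by rewrite /dtime derive1E.
apply: diff_derivable; apply: smooth_on_differentiable (smooth_time_at x su) _.
by [].
Qed.

(** Two-sided limits need increments of both signs, so the mean value theorem is applied on
    [t, h + t] or on [h + t, t]. *)
Lemma MVT_increment (f df : R -> R) (t h : R) :
  (forall s : R, is_derive s 1 f (df s)) ->
  exists2 c, `|c - t| <= `|h| & f (h + t) - f t = df c * h.
Proof.
move=> Df.
have cf a b : {within `[a, b], continuous f}.
  apply: continuous_subspaceT => s; apply: differentiable_continuous.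
  by apply/derivable1_diffP; have [] := Df s.
have [h0|h0] := leP 0 h.
  have th : t <= h + t by rewrite lerDr.
  have [c + E] := MVT_segment th (fun s _ => Df s) (cf _ _).
  rewrite in_itv /= => /andP[tc ct]; exists c; last by rewrite E addrK.
  by rewrite !ger0_norm //; lra.
have th : h + t <= t by lra.
have [c + E] := MVT_segment th (fun s _ => Df s) (cf _ _).
rewrite in_itv /= => /andP[tc ct]; exists c; last first.
  by rewrite -opprB E; ring.
by rewrite !ler0_norm //; lra.
Qed.

Lemma compact_unit_sphere : compact [set y : V | eucl_norm y = 1].
Proof.
apply: bounded_closed_compact.
  exists 1; split => // M M1 y /= y1.
  rewrite -[`|y|]/(mx_norm y) mx_normrE; apply: bigmax_le => [|[i j] _ /=].
    by rewrite ltW // (lt_trans _ M1).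
  rewrite (ord1 i); apply: le_trans (ltW M1).
  by rewrite -y1; exact: norm_coord_le.
rewrite (_ : mkset _ = (fun y : V => dotp y y) @^-1` [set 1]); last first.
  apply/seteqP; split=> y /=; rewrite -eucl_norm_sqr => E; first by rewrite E expr1n.
  by apply/eqP; rewrite -(@eqrXn2 _ 2) ?eucl_norm_ge0 // E expr1n.
apply: closed_comp; last first.
  exact/accessible_closed_set1/hausdorff_accessible/norm_hausdorff.
move=> y _; apply: differentiable_continuous.
apply: (smooth_on_differentiable (A := setT)) => //.
by apply: smooth_on_dotpxx; exact: openT.
Qed.

(** Uniformity in [x] is what permits differentiation under the spherical mean. The mean value
    theorem turns the quotient into a value of [dtime u x] at a nearby time, and compactness of the
    sphere makes the continuity of [dtime u] in time uniform. *)
Lemma dtime_uniform u (t e : R) : smooth_time u -> 0 < e ->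
  \forall h \near (0 : R)^',
    forall x, `|h^-1 * (u x (h + t) - u x t) - dtime u x t| <= e.
Proof.
move=> su e0.
pose D (p : V * R) := dtime u (retract p.1) p.2.
have cD (y : V) : eucl_norm y = 1 -> {for (y, t), continuous D}.
  move=> y1; apply: differentiable_continuous.
  apply: (smooth_on_differentiable (smooth_time_dtime su)).
  by rewrite /punctured_time /= -eucl_norm_eq0 y1 oner_eq0.
(* Compactness turns neighbourhoods of the points (y, t) into a single neighbourhood of [t] valid
   for all unit vectors. *)
have /compact_near_coveringP/(_ _ (nbhs t)
  (fun s y => `|D (y, s) - D (y, t)| <= e) _) := compact_unit_sphere.
have H : forall y : V, eucl_norm y = 1 ->
    \forall y' \near y & s \near t, `|D (y', s) - D (y', t)| <= e.
  move=> y y1.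
  have e2 : 0 < e / 2 by rewrite divr_gt0.
  have /cvgr_dist_lt/(_ _ e2) := cD y y1.
  move=> [[A B] /= [nA nB] AB].
  exists (A, B) => // -[y' s] /= [Ay' Bs].
  have := AB (y', s) (conj Ay' Bs).
  have := AB (y', t) (conj Ay' (nbhs_singleton nB)).
  rewrite /= => h1 h2.
  rewrite (_ : _ - _ = (D (y, t) - D (y', t)) - (D (y, t) - D (y', s))); last by ring.
  by apply: le_trans (ler_normB _ _) _; lra.
move=> /(_ H) -/nbhs_ballP[d /= d0 dH].
exists d => //= h; rewrite /ball_ /= sub0r normrN => hd hN0 x.
have [c ct ->] := @MVT_increment (u x) (dtime u x) t h (fun s => is_derive_dtime x s su).
rewrite mulrC mulfK //.
have := dH c; rewrite /ball /= distrC => /(_ (le_lt_trans ct hd) (val x)).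
by rewrite /D /= retract_val; apply; exact: (eqP (valP x)).
Qed.

Lemma dtimeD (a : R) u v x t : smooth_time u -> smooth_time v ->
  dtime (fun x t => a * u x t + v x t) x t = a * dtime u x t + dtime v x t.
Proof.
move=> su sv; rewrite /dtime !derive1E.
have Du := is_derive_dtime x t su; have Dv := is_derive_dtime x t sv.
have -> : (fun t => a * u x t + v x t) = a *: u x + v x by [].
by rewrite deriveD ?deriveZ.
Qed.

Lemma smooth_time_lin (a : R) u v : smooth_time u -> smooth_time v ->
  smooth_time (fun x t => a * u x t + v x t).
Proof.
move=> su sv; apply: smooth_time_add => //; apply: smooth_on_mul => //.
  exact: open_punctured_time.
exact: smooth_on_cst.
Qed.

Lemma laplace_beltrami_lin (a : R) f g x : smooth_sphere f -> smooth_sphere g ->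
  laplace_beltrami (fun x => a * f x + g x) x =
  a * laplace_beltrami f x + laplace_beltrami g x.
Proof.
move=> sf sg; rewrite !laplace_beltramiE mulr_sumr -big_split.
apply: eq_bigr => i _ /=.
have saf : smooth_sphere (fun y => a * f y).
  by apply: smooth_sphere_mul => //; exact: smooth_sphere_cst.
rewrite (_ : dcoord i (fun y => a * f y + g y) =
    fun y => a * dcoord i f y + dcoord i g y); last first.
  by apply/funext => y; rewrite dcoordD // dcoordZ.
have sdf := smooth_sphere_dcoord i sf; have sdg := smooth_sphere_dcoord i sg.
rewrite dcoordD // ?dcoordZ //.
by apply: smooth_sphere_mul => //; exact: smooth_sphere_cst.
Qed.

Definition real_wave u :=
  smooth_time u /\ forall x t,
    laplace_beltrami (u ^~ t) x - ((n%:R - 1) / 2) ^+ 2 * u x t = dtime (dtime u) x t.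

Lemma real_wave_lin (a : R) u v : real_wave u -> real_wave v ->
  real_wave (fun x t => a * u x t + v x t).
Proof.
move=> [su Eu] [sv Ev]; split; first exact: smooth_time_lin.
move=> x t; rewrite laplace_beltrami_lin; try exact: smooth_time_slice.
rewrite (_ : dtime (fun x t => a * u x t + v x t) =
    fun x t => a * dtime u x t + dtime v x t); last first.
  by apply/funext => y; apply/funext => s; exact: dtimeD.
rewrite dtimeD; try exact: smooth_time_dtime.
rewrite -Eu -Ev; move: (laplace_beltrami _ x) (laplace_beltrami _ x) => p q.
by move: (_ ^+ 2) (u x t) (v x t) => k b c; ring.
Qed.

Lemma complex_subZ (k p q a b : R) :
  (p +i* q - k%:C * (a +i* b) = (p - k * a) +i* (q - k * b))%C.
Proof. by apply/eqP; rewrite eq_complex /=; apply/andP; split; apply/eqP; ring. Qed.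

(** The equation has real coefficients and its operators act on real and imaginary parts
    separately. *)
Lemma waveP (w : S -> R -> R[i]) : wave w <->
  real_wave (fun x t => complex.Re (w x t)) /\
  real_wave (fun x t => complex.Im (w x t)).
Proof.
have H (k p q p' q' : R) (z : R[i]) :
    ((p +i* q) - k%:C * z = p' +i* q')%C <->
    p - k * complex.Re z = p' /\ q - k * complex.Im z = q'.
  case: z => a b; rewrite complex_subZ /=.
  by split=> [/eqP|[-> ->]//]; rewrite eq_complex => /andP[/eqP ? /eqP ?].
split=> [[/smooth_sphere_timeP sr /smooth_sphere_timeP si E]|[[sr Er] [si Ei]]].
  split; split.
  - exact: sr.
  - by move=> x t; case: ((H _ _ _ _ _ _).1 (E x t)) => + _; apply.
  - exact: si.
  - by move=> x t; case: ((H _ _ _ _ _ _).1 (E x t)) => _; apply.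
split; try exact/smooth_sphere_timeP.
by move=> x t; apply: (H _ _ _ _ _ _).2; split; [exact: Er|exact: Ei].
Qed.

End TimeDerivative.

(** * Grid means *)

Section UltraLimit.
Context {R : realType}.

Lemma ultrafilter_infty : exists U : set_system nat, UltraFilter U /\ \oo `<=` U.
Proof. exact: ultraFilterLemma. Qed.

Definition ufilter : set_system nat := projT1 (cid ultrafilter_infty).

Instance ufilter_ultra : UltraFilter ufilter.
Proof. by rewrite /ufilter; case: cid => U []. Qed.

Lemma ufilter_infty (A : set nat) : (\forall m \near \oo, A m) -> ufilter A.
Proof. by rewrite /ufilter; case: cid => U [UU] /=; apply. Qed.

(* Meaningful for bounded sequences only. *)
Definition ulim (a : nat -> R) : R := lim (a @ ufilter).

(** The values lie in a compact interval, so there is a cluster point along the ultrafilter, and a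
    cluster point of an ultrafilter is a limit. *)
Lemma cvg_ulim (a : nat -> R) (C : R) : (forall m, `|a m| <= C) ->
  a @ ufilter --> ulim a.
Proof.
move=> aC; apply/cvg_ex.
have [p [_ clp]] : [set` `[-C, C]] `&` cluster (a @ ufilter) !=set0.
  apply: (@segment_compact R (-C) C); apply: (@filterE _ ufilter) => m.
  by rewrite /= in_itv /= -ler_norml.
exists p => B nB; have [//|UB] := in_ultra_setVsetC (a @^-1` B) ufilter_ultra.
have [q [nq Bq]] := clp (~` B) B UB nB.
by case: nq.
Qed.

Lemma ulimD (a b : nat -> R) (C D : R) :
  (forall m, `|a m| <= C) -> (forall m, `|b m| <= D) ->
  ulim (fun m => a m + b m) = ulim a + ulim b.
Proof. by move=> /cvg_ulim ca /cvg_ulim cb; apply: cvg_lim => //; exact: cvgD. Qed.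

Lemma ulimZ (k : R) (a : nat -> R) (C : R) :
  (forall m, `|a m| <= C) -> ulim (fun m => k * a m) = k * ulim a.
Proof.
by move=> /cvg_ulim ca; apply: cvg_lim => //; exact: (cvgM (cvg_cst k) ca).
Qed.

Lemma ulim_le (a b : nat -> R) (C D : R) :
  (forall m, `|a m| <= C) -> (forall m, `|b m| <= D) ->
  (\forall m \near \oo, a m <= b m) -> ulim a <= ulim b.
Proof.
move=> /cvg_ulim ca /cvg_ulim cb ab.
by apply: (ler_cvg_to ca cb); exact: ufilter_infty.
Qed.

Lemma ulim_cst (a : R) : ulim (fun=> a) = a.
Proof. by apply: cvg_lim => //; exact: cvg_cst. Qed.

Lemma ulim_eq0 (a : nat -> R) :
  (forall e : R, 0 < e -> \forall m \near \oo, `|a m| <= e) -> ulim a = 0.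
Proof.
move=> H; apply: cvg_lim => //; apply/cvgr0Pnorm_le => e e0.
by apply: ufilter_infty; exact: H.
Qed.

End UltraLimit.

(** * Cyclic grids and summation by parts *)

Section Grid.
Context {R : realType} {n : nat}.
Local Notation V := ('rV[R]_n.+1).

(* ['I_(4 * m).+4] is cyclic of order 4(m + 1), so that a translation by one step
   is a permutation of the grid. *)
Definition grid (m : nat) : finType := 'rV['I_(4 * m).+4]_n.+1.

(** The points have mesh 1/(m + 1) and fill the box [-2, 2)^(n+1), which contains the unit sphere
    and the support of the cutoff used below. *)
Definition grid_point m (k : grid m) : V := \row_i (- 2 + (k 0 i)%:R / m.+1%:R).

Definition grid_mean m (F : V -> R) : R :=
  (\sum_(k : grid m) F (grid_point k)) / #|grid m|%:R.

Lemma grid_card_gt0 m : 0 < #|grid m|%:R :> R.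
Proof. by rewrite ltr0n; apply/card_gt0P; exists 0. Qed.

Lemma grid_meanD m F G :
  grid_mean m (fun x => F x + G x) = grid_mean m F + grid_mean m G.
Proof. by rewrite /grid_mean -mulrDl -big_split. Qed.

Lemma grid_meanZ m (a : R) F : grid_mean m (fun x => a * F x) = a * grid_mean m F.
Proof. by rewrite /grid_mean -mulr_sumr mulrA. Qed.

Lemma grid_mean_le m F G : (forall k : grid m, F (grid_point k) <= G (grid_point k)) ->
  grid_mean m F <= grid_mean m G.
Proof.
move=> FG; rewrite ler_pM2r ?invr_gt0 ?grid_card_gt0 //.
by apply: ler_sum => k _; exact: FG.
Qed.

Lemma grid_mean_cst m (a : R) : grid_mean m (cst a) = a.
Proof.
rewrite /grid_mean /= sumr_const -[_ *+ _]mulr_natr mulfK //.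
by rewrite gt_eqF // grid_card_gt0.
Qed.

Lemma grid_mean_norm m F (C : R) : (forall k : grid m, `|F (grid_point k)| <= C) ->
  `|grid_mean m F| <= C.
Proof.
move=> FC; have H (k : grid m) : - C <= F (grid_point k) <= C.
  by rewrite -ler_norml.
rewrite ler_norml; apply/andP; split.
  by rewrite -[leLHS](grid_mean_cst m); apply: grid_mean_le => k; case/andP: (H k).
by rewrite -[leRHS](grid_mean_cst m); apply: grid_mean_le => k; case/andP: (H k).
Qed.

Lemma grid_mean_sum m I (r : seq I) (F : I -> V -> R) :
  grid_mean m (fun x => \sum_(i <- r) F i x) = \sum_(i <- r) grid_mean m (F i).
Proof.
elim: r => [|i r IH].
  rewrite big_nil -[RHS](grid_mean_cst m 0); congr grid_mean.
  by apply/funext => x; rewrite big_nil.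
rewrite big_cons -IH -grid_meanD; congr grid_mean.
by apply/funext => x; rewrite big_cons.
Qed.

Lemma grid_point_box m (k : grid m) i : `|grid_point k 0 i| <= 2.
Proof.
rewrite mxE ler_norml; have := ltn_ord (k 0 i); set j := val (k 0 i) => jm.
have m0 : 0 < m.+1%:R :> R by rewrite ltr0n.
have : 0 <= j%:R / m.+1%:R :> R by rewrite divr_ge0.
have : j%:R / m.+1%:R <= 4 :> R.
  by rewrite ler_pdivrMr // -natrM ler_nat; lia.
by move: (_ / _) => X X4 X0; apply/andP; split; lra.
Qed.

(** Translating the index and translating the point differ only when the index wraps round. Then one
    point has i-th coordinate -2, the other 2, and [F] vanishes at both. *)
Lemma grid_point_shift m (k : grid m) i (F : V -> R) :
  (forall (x : V) j, 2 <= `|x 0 j| -> F x = 0) ->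
  F (grid_point (k + delta_mx 0 i : grid m)) =
  F (grid_point k + m.+1%:R^-1 *: delta_mx 0 i).
Proof.
move=> F0.
have m0 : m.+1%:R != 0 :> R by rewrite pnatr_eq0.
have vE j : val ((k + delta_mx 0 i : grid m) 0 j) =
    ((k 0%R j + (j == i)) %% (4 * m).+4)%N.
  by rewrite !mxE eqxx /=; case: (j == i) => //=; rewrite modnDmr.
have [lt|ge] := ltnP (k 0 i).+1 (4 * m).+4.
  congr F; apply/rowP => j.
  rewrite [LHS]mxE vE [RHS]mxE [X in _ = X + _]mxE !mxE eqxx /=.
  have [->|ji] := eqVneq j i; last by rewrite addn0 modn_small // mulr0 addr0.
  rewrite addn1 modn_small // -[(k 0 i).+1%:R]natr1 mulr1.
  by rewrite mulrDl mul1r addrA.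
have kiE : (k 0 i).+1 = (4 * m).+4 by apply/eqP; rewrite eqn_leq ltn_ord.
rewrite (F0 _ i) ?(F0 _ i) //.
- rewrite !mxE !eqxx /= mulr1 -addrA -[X in _ + (_ + X)]mul1r -mulrDl natr1 kiE.
  rewrite (_ : (4 * m).+4 = (4 * m.+1)%N); last by lia.
  by rewrite natrM mulfK // ger0_norm; lra.
- by rewrite mxE vE eqxx addn1 kiE modnn mul0r addr0 normrN ger0_norm.
Qed.

Lemma grid_mean_shift m i (F : V -> R) :
  (forall (x : V) j, 2 <= `|x 0 j| -> F x = 0) ->
  grid_mean m (fun x => F (x + m.+1%:R^-1 *: delta_mx 0 i)) = grid_mean m F.
Proof.
move=> F0; congr (_ / _); rewrite [RHS](reindex_inj (addIr (delta_mx 0 i))) /=.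
by apply: eq_bigr => k _; rewrite grid_point_shift.
Qed.

Lemma compact_box (r : R) : compact [set x : V | forall i, `|x 0 i| <= r].
Proof.
have := @rV_compact R n.+1 (fun=> [set` `[- r, r]]) (fun=> @segment_compact R _ _).
congr compact; apply/seteqP; split=> x /= H i; have := H i;
  by rewrite in_itv /= ler_norml.
Qed.

Lemma is_derive_along (G g : V -> R) (v x : V) (s : R) :
  (forall x, is_derive x v G (g x)) ->
  is_derive s 1 (fun s => G (x + s *: v)) (g (x + s *: v)).
Proof.
move=> DG; have [dG gE] := DG (x + s *: v).
have E : (fun h : R => h^-1 *:
      (((fun s => G (x + s *: v)) \o shift s) (h *: (1 : R)) - G (x + s *: v))) =
    (fun h : R => h^-1 *: ((G \o shift (x + s *: v)) (h *: v) - G (x + s *: v))).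
  apply/funext => h /=; congr (_ *: (G _ - _)).
  by rewrite [_ *: 1]mulr1 scalerDl addrCA.
apply: DeriveDef; first by move: dG; rewrite /derivable -E.
by rewrite -gE /derive -E.
Qed.

(** With h = 1/(m + 1), the difference quotient (G(x + h v) - G(x)) / h has grid mean 0 by
    translation invariance, and it tends to [g] uniformly on the box. *)
Lemma grid_mean_derive i (G g : V -> R) :
  continuous g -> (forall x, is_derive x (delta_mx 0 i) G (g x)) ->
  (forall (x : V) j, 2 <= `|x 0 j| -> G x = 0) ->
  forall e : R, 0 < e -> \forall m \near \oo, `|grid_mean m g| <= e.
Proof.
move=> cg DG G0 e e0; set v := delta_mx 0 i in DG.
have cgv (x : V) (s : R) :
    {for (x, s), continuous (fun p : V * R => g (p.1 + p.2 *: v))}.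
  apply: (continuous_comp (f := fun p : V * R => p.1 + p.2 *: v)); last exact: cg.
  apply: cvgD; first exact: cvg_fst.
  by apply: cvgZr_tmp; exact: cvg_snd.
have /compact_near_coveringP/(_ _ (nbhs (0 : R))
    (fun s x => `|g (x + s *: v) - g x| <= e) _) := @compact_box 2.
have H : forall x : V, (forall j, `|x 0 j| <= 2) ->
    \forall x' \near x & s \near (0 : R), `|g (x' + s *: v) - g x'| <= e.
  move=> x _; have e2 : 0 < e / 2 by rewrite divr_gt0.
  have /cvgr_dist_lt/(_ _ e2) := cgv x 0.
  move=> [[A B] /= [nA nB] AB].
  exists (A, B) => // -[x' s] /= [Ax' Bs].
  have := AB (x', s) (conj Ax' Bs).
  have := AB (x', 0) (conj Ax' (nbhs_singleton nB)).
  rewrite /= !scale0r !addr0 => h1 h2.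
  rewrite (_ : _ - _ = (g x - g x') - (g x - g (x' + s *: v))); last by ring.
  by apply: le_trans (ler_normB _ _) _; lra.
move=> /(_ H) -/nbhs_ballP[d /= d0 dH].
near=> m.
have hd : m.+1%:R^-1 < d.
  by near: m; exact: near_infty_natSinv_lt (PosNum d0).
have h0 : 0 < m.+1%:R^-1 :> R by rewrite invr_gt0.
have := grid_mean_shift m i G0.
set h : R := m.+1%:R^-1 in hd h0 *; rewrite -/v => SE.
(* Subtract the difference quotient, whose mean is 0. *)
rewrite (_ : grid_mean m g =
    grid_mean m (fun x => g x + (- h^-1) * (G (x + h *: v) + (-1) * G x))); last first.
  by rewrite grid_meanD grid_meanZ grid_meanD grid_meanZ SE; ring.
apply: grid_mean_norm => k; set x := grid_point k.
have [c] := @MVT_increment _ (fun s => G (x + s *: v)) (fun s => g (x + s *: v)) 0 h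
  (fun s => is_derive_along x s DG).
rewrite addr0 scale0r addr0 subr0 (gtr0_norm h0) => ch.
rewrite mulN1r => ->; rewrite mulNr mulrCA mulVf ?gt_eqF // mulr1 distrC.
apply: (dH c _ x) => [|j]; last exact: grid_point_box.
by rewrite /ball /= sub0r normrN (le_lt_trans ch).
Unshelve. all: by end_near. Qed.

End Grid.

(** * Lower bounds for grid means *)

Section GridLowerBound.
Context {R : realType} {n : nat}.
Local Notation V := ('rV[R]_n.+1).

Lemma grid_card m : #|@grid n m| = ((4 * m).+4 ^ n.+1)%N.
Proof. by rewrite card_mx card_ord mul1n. Qed.

Lemma grid_mean_card_le m a c (F : V -> R) (phi : 'rV['I_a]_n.+1 -> @grid n m) :
  injective phi -> (forall x, 0 <= F x) ->
  (forall j, c <= F (grid_point (phi j))) ->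
  c * (a%:R / (4 * m).+4%:R) ^+ n.+1 <= grid_mean m F.
Proof.
move=> phiI F0 cF; rewrite expr_div_n mulrA /grid_mean grid_card natrX.
rewrite ler_pM2r ?invr_gt0 ?exprn_gt0 ?ltr0n //.
rewrite (bigID (mem [set phi j | j in [set: 'rV['I_a]_n.+1]]%SET)) /=.
rewrite -[leLHS]addr0 lerD ?sumr_ge0 //.
rewrite big_imset /=; last by move=> i j _ _; exact: phiI.
apply: le_trans (_ : \sum_(j in [set: 'rV['I_a]_n.+1]%SET) c <= _); last first.
  by apply: ler_sum => j _; exact: cF.
by rewrite sumr_const cardsT card_mx card_ord mul1n -[leRHS]mulr_natr natrX.
Qed.

(** On each axis about r(m + 1) of the 4(m + 1) grid coordinates lie in [y_j - r, y_j]. Rounding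
    costs at most a factor 2 once r(m + 1) >= 2, which gives the proportion r/8. *)
Lemma grid_mean_ge (y : V) (r c : R) (F : V -> R) :
  (forall j, `|y 0 j| <= 1) -> 0 < r <= 1 -> 0 <= c ->
  (forall x, 0 <= F x) ->
  (forall x : V, (forall j, `|x 0 j - y 0 j| <= r) -> c <= F x) ->
  \forall m \near \oo, c * (r / 8) ^+ n.+1 <= grid_mean m F.
Proof.
move=> y1 /andP[r0 r1] c0 F0 cF; near=> m.
have rm : 2 / r <= m%:R by near: m; exact: nbhs_infty_ger.
set M : R := m.+1%:R.
have Mm : m%:R <= M by rewrite ler_nat.
have M0 : 0 < M by rewrite ltr0n.
have rM2 : 2 <= r * M.
  by rewrite mulrC -ler_pdivrMr // (le_trans rm).
(* On the j-th axis, [a] consecutive indices are used, starting from [b j], the first one whose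
   coordinate exceeds y_j - r. *)
pose a := Num.truncn (r * M).
have a1 : r * M < a%:R + 1 by rewrite natr1; exact: truncnS_gt.
have a2 : a%:R <= r * M by rewrite -truncn_ge_nat // ltW // mulr_gt0.
have LE : (4 * m).+4%:R = 4 * M :> R.
  by rewrite -natrM; congr _%:R; lia.
pose b j := (Num.truncn ((y 0 j - r + 2) * M)).+1.
have yb j : -1 <= y 0 j <= 1 by rewrite -ler_norml.
have b1 j : (y 0 j - r + 2) * M < (b j)%:R by exact: truncnS_gt.
have b2 j : (b j)%:R <= (y 0 j - r + 2) * M + 1.
  rewrite /b -natr1 lerD2r -truncn_ge_nat //.
  by apply: mulr_ge0 (ltW M0); have /andP[] := yb j; lra.
have bq j (i : nat) : (i < a)%N ->
    y 0 j - r + 2 <= (b j + i)%:R / M <= y 0 j + 2.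
  move=> ia.
  have i0 : 0 <= i%:R :> R by [].
  have i1 : i%:R + 1 <= a%:R :> R by rewrite natr1 ler_nat.
  set q := (b j + i)%:R / M.
  have qE : q * M = (b j)%:R + i%:R by rewrite /q mulfVK ?gt_eqF // natrD.
  by apply/andP; split; rewrite -(ler_pM2r M0) qE;
    [have := b1 j; lra|have := b2 j; nra].
have bL j i : (i < a)%N -> (b j + i < (4 * m).+4)%N.
  move=> /(bq j)/andP[_ H]; have /andP[_ yj] := yb j.
  have q4 : (b j + i)%:R / M < 4 by apply: le_lt_trans H _; lra.
  by rewrite -(ltr_nat R) LE -ltr_pdivrMr.
pose phi (k : 'rV['I_a]_n.+1) : @grid n m := \row_j inord (b j + k ord0 j).
apply: le_trans (@grid_mean_card_le m a c F phi _ F0 _).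
- apply: ler_wpM2l => //; apply: lerXn2r; rewrite ?nnegrE ?divr_ge0 ?(ltW r0) //.
  by rewrite LE ler_pdivlMr ?mulr_gt0 //; lra.
- move=> k l /rowP kl; apply/rowP => j; have := kl j; rewrite !mxE.
  move=> /(congr1 val) /=; rewrite !inordK ?bL // => /addnI H.
  by apply: val_inj.
- move=> k; apply: cF => j; rewrite !mxE inordK ?bL //.
  have /andP[q1 q2] := bq j _ (ltn_ord (k ord0 j)).
  move: q1 q2; move: (_ / M) => q q1 q2.
  by rewrite ler_norml; apply/andP; split; lra.
Unshelve. all: by end_near. Qed.

End GridLowerBound.

(** * A radial cutoff *)

Section Weight.
Context {R : realType}.

(** A quadratic error bound settles the derivative of [pos_sqr] also at 0, where its two formulas
    meet, without one-sided limits. *)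
Lemma is_derive_quadratic (f : R -> R) (x l : R) :
  (forall h, `|f (h + x) - f x - l * h| <= h ^+ 2) -> is_derive x 1 f l.
Proof.
move=> H.
have C : (fun h => h^-1 *: ((f \o shift x) (h *: 1) - f x)) @ 0^' --> l.
  apply/cvgrPdist_le => e e0; near=> h.
  have h0 : h != 0 by near: h; exact: nbhs_dnbhs_neq.
  have he : `|h| <= e.
    by near: h; exact: dnbhs0_le.
  have := H h; rewrite /= [h *: 1]mulr1 => Hh.
  rewrite (_ : _ - _ = - (h^-1 * (f (h + x) - f x - l * h))); last first.
    by rewrite /GRing.scale /=; field.
  rewrite normrN normrM normfV ler_pdivrMl ?normr_gt0 //.
  apply: le_trans Hh _; rewrite -real_normK ?num_real // expr2.
  by rewrite ler_wpM2l.
apply: DeriveDef; first exact: cvgP C.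
exact: cvg_lim C.
Unshelve. all: by end_near. Qed.

Definition pos_sqr (z : R) : R := Num.max 0 z ^+ 2.

Lemma is_derive_pos_sqr (z : R) : is_derive z 1 pos_sqr (2 * Num.max 0 z).
Proof.
apply: is_derive_quadratic => h; rewrite /pos_sqr.
have [a0|a0] := leP 0 (h + z); have [b0|b0] := leP 0 z;
  rewrite ler_norml; apply/andP; split; nra.
Qed.

(* Continuously differentiable and supported in [1/2, 2]; applied to |x|^2. *)
Definition cutoff (rho : R) : R := pos_sqr ((rho - 1 / 2) * (2 - rho)).

Definition dcutoff (rho : R) : R :=
  2 * Num.max 0 ((rho - 1 / 2) * (2 - rho)) * (5 / 2 - 2 * rho).

Lemma is_derive_cutoff (rho : R) : is_derive rho 1 cutoff (dcutoff rho).
Proof.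
have D := is_derive_pos_sqr ((rho - 1 / 2) * (2 - rho)).
have Dp : is_derive rho 1 ((fun x => (x - 1 / 2)) * (fun x => 2 - x))
    (5 / 2 - 2 * rho).
  by apply: is_derive_eq; rewrite /GRing.scale /=; field.
exact: (@is_derive1_comp R pos_sqr
  ((fun x => (x - 1 / 2)) * (fun x => 2 - x)) rho _ _ D Dp).
Qed.

Lemma cutoff_ge0 rho : 0 <= cutoff rho.
Proof. exact: sqr_ge0. Qed.

Lemma cutoff_le1 rho : cutoff rho <= 1.
Proof.
rewrite /cutoff /pos_sqr; have [z0|z0] := leP 0 ((rho - 1 / 2) * (2 - rho)).
  (* The quadratic polynomial equals 9/16 - (rho - 5/4)^2. *)
  by rewrite exprn_ile1 //; have := sqr_ge0 (rho - 5 / 4); nra.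
by rewrite expr0n /=.
Qed.

Lemma cutoff_small rho : rho <= 1 / 2 -> cutoff rho = 0.
Proof.
move=> h; rewrite /cutoff /pos_sqr; case: leP => [z0|_]; last by rewrite expr0n.
have -> : (rho - 1 / 2) * (2 - rho) = 0 by nra.
by rewrite expr0n.
Qed.

Lemma cutoff_large rho : 2 <= rho -> cutoff rho = 0.
Proof.
move=> h; rewrite /cutoff /pos_sqr; case: leP => [z0|_]; last by rewrite expr0n.
have -> : (rho - 1 / 2) * (2 - rho) = 0 by nra.
by rewrite expr0n.
Qed.

Lemma cutoff1_gt0 : 0 < cutoff 1.
Proof.
by rewrite /cutoff /pos_sqr max_r ?exprn_gt0 //; lra.
Qed.

Lemma continuous_dcutoff : continuous dcutoff.
Proof.
have ca (a : R) : continuous (fun x : R => x - a).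
  by move=> x; apply: cvgB; [exact: cvg_id|exact: cvg_cst].
have cb (a b : R) : continuous (fun x : R => a - b * x).
  move=> x; apply: cvgB; first exact: cvg_cst.
  by apply: cvgM; [exact: cvg_cst|exact: cvg_id].
have cq : continuous (fun x : R => (x - 1 / 2) * (2 - x)).
  move=> x; apply: (@cvgM _ _ _ _ (fun x => x - 1 / 2)); first exact: ca.
  by apply: cvgB; [exact: cvg_cst|exact: cvg_id].
move=> x; apply: (@cvgM _ _ _ _ (fun x => 2 * Num.max 0 ((x - 1 / 2) * (2 - x))));
  last exact: cb.
apply: cvgM; first exact: cvg_cst.
exact: (@continuous_max _ _ (cst 0) _ x (@cst_continuous _ _ _ _) (cq x)).
Qed.

End Weight.

(** * The spherical mean *)

Section SphericalMean.
Context {R : realType} {n : nat}.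
Local Notation V := ('rV[R]_n.+1).
Local Notation S := (sphere R n).
Implicit Types (f g : S -> R) (u : S -> R -> R).

(* The factor 1 / |x| cancels the factor |x| of [dcoord_ext]. *)
Definition weight (x : V) : R := cutoff (dotp x x) / eucl_norm x.

Lemma weight_ge0 x : 0 <= weight x.
Proof. by rewrite divr_ge0 ?cutoff_ge0 ?eucl_norm_ge0. Qed.

(** Where the cutoff does not vanish, |x|^2 > 1/2 and so 1/|x| < 2. *)
Lemma weight_le2 x : weight x <= 2.
Proof.
rewrite /weight; have [small|large] := leP (dotp x x) (1 / 2).
  by rewrite cutoff_small // mul0r.
have N0 := eucl_norm_ge0 x.
have N1 : 1 / 2 <= eucl_norm x by have := eucl_norm_sqr x; nra.
by rewrite ler_pdivrMr; [have := cutoff_le1 (dotp x x); lra|lra].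
Qed.

Definition grid_smean m f : R := grid_mean m (fun x => weight x * f (retract x)).

(** For continuous [f] this is a fixed positive multiple of the surface integral; it is not
    normalised. The limit along the ultrafilter exists for every bounded [f], indicator functions
    included. *)
Definition smean f : R := ulim (fun m => grid_smean m f).

Lemma grid_smean_norm m f (C : R) : (forall x, `|f x| <= C) ->
  `|grid_smean m f| <= 2 * C.
Proof.
move=> fC; apply: grid_mean_norm => k; rewrite normrM ler_pM //.
by rewrite ger0_norm ?weight_ge0 // weight_le2.
Qed.

Lemma smeanD f g (C D : R) : (forall x, `|f x| <= C) -> (forall x, `|g x| <= D) ->
  smean (fun x => f x + g x) = smean f + smean g.
Proof.
move=> fC gD; rewrite
  -(ulimD (fun m => grid_smean_norm m fC) (fun m => grid_smean_norm m gD)).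
congr ulim; apply/funext => m; rewrite -grid_meanD; congr grid_mean.
by apply/funext => x; rewrite mulrDr.
Qed.

Lemma smeanZ (a : R) f (C : R) : (forall x, `|f x| <= C) ->
  smean (fun x => a * f x) = a * smean f.
Proof.
move=> fC; rewrite -(ulimZ a (fun m => grid_smean_norm m fC)).
congr ulim; apply/funext => m; rewrite -grid_meanZ; congr grid_mean.
by apply/funext => x; rewrite mulrCA.
Qed.

Lemma smean_le f g (C D : R) : (forall x, `|f x| <= C) -> (forall x, `|g x| <= D) ->
  (forall x, f x <= g x) -> smean f <= smean g.
Proof.
move=> fC gD fg.
apply: (ulim_le (fun m => grid_smean_norm m fC) (fun m => grid_smean_norm m gD)).
apply: nearW => m; apply: grid_mean_le => k.
by rewrite ler_wpM2l // weight_ge0.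
Qed.

Lemma smean0 : smean (cst 0) = 0.
Proof.
apply: ulim_eq0 => e e0; apply: nearW => m; apply: grid_mean_norm => k.
by rewrite mulr0 normr0 ltW.
Qed.

Lemma smean_norm f (C : R) : (forall x, `|f x| <= C) -> `|smean f| <= 2 * C.
Proof.
move=> fC; have C0 : 0 <= C by exact: le_trans (normr_ge0 _) (fC (pole n)).
have H m := grid_smean_norm m fC.
rewrite ler_norml; apply/andP; split.
  rewrite -(ulim_cst (- (2 * C))); apply: (ulim_le (C := 2 * C) _ H) => [m|].
    by rewrite normrN ger0_norm // mulr_ge0.
  by apply: nearW => m; have := H m; rewrite ler_norml => /andP[].
rewrite -[leRHS](ulim_cst (2 * C)); apply: (ulim_le (D := 2 * C) H) => [m|].
  by rewrite ger0_norm // mulr_ge0.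
by apply: nearW => m; have := H m; rewrite ler_norml => /andP[].
Qed.

Lemma smooth_sphere_bounded f : smooth_sphere f -> exists C : R, forall x, `|f x| <= C.
Proof.
move=> sf.
have cf : {within [set y : V | eucl_norm y = 1], continuous (f \o @retract R n)}.
  apply: continuous_in_subspaceT => y; rewrite inE /= => y1.
  apply: differentiable_continuous; apply: (smooth_on_differentiable sf).
  by rewrite /punctured /= -eucl_norm_eq0 y1 oner_eq0.
have /compact_bounded[M [_ HM]] := continuous_compact cf (@compact_unit_sphere R n).
exists (M + 1) => x; apply: HM; first by rewrite ltrDl.
by exists (val x); [exact: (eqP (valP x))|rewrite /= retract_val].
Qed.

Lemma smean_lin (a : R) f g : smooth_sphere f -> smooth_sphere g ->
  smean (fun x => a * f x + g x) = a * smean f + smean g.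
Proof.
move=> /smooth_sphere_bounded[C fC] /smooth_sphere_bounded[D gD].
rewrite -(smeanZ a fC); apply: (smeanD (C := `|a| * C) _ gD) => x.
by rewrite normrM ler_wpM2l.
Qed.

(** The difference quotients converge uniformly on the sphere, and the mean is bounded by twice the
    sup norm. *)
Lemma smean_dtime u (t : R) : smooth_time u ->
  is_derive t 1 (fun s => smean (u ^~ s)) (smean (dtime u ^~ t)).
Proof.
move=> su.
have su' s := smooth_time_slice s su.
have sdu := smooth_time_slice t (smooth_time_dtime su).
have C : (fun h => h^-1 *: (((fun s => smean (u ^~ s)) \o shift t) (h *: 1) -
    smean (u ^~ t))) @ 0^' --> smean (dtime u ^~ t).
  apply/cvgrPdist_le => e e0; have e2 : 0 < e / 2 by rewrite divr_gt0.
  near=> h; have H : forall x, `|h^-1 * (u x (h + t) - u x t) - dtime u x t| <= e / 2.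
    by near: h; exact: (dtime_uniform t su e2).
  rewrite /= [h *: 1]mulr1 distrC.
  rewrite (_ : _ - _ = smean (fun x => h^-1 * (u x (h + t) - u x t) - dtime u x t)).
    by apply: le_trans (smean_norm H) _; lra.
  have s1 : smooth_sphere (fun x => (-1) * u x t + u x (h + t)).
    apply: smooth_sphere_add => //; apply: smooth_sphere_mul => //.
    exact: smooth_sphere_cst.
  have s2 : smooth_sphere (fun x => h^-1 * ((-1) * u x t + u x (h + t))).
    by apply: smooth_sphere_mul => //; exact: smooth_sphere_cst.
  rewrite [in RHS](_ : (fun x => _) = fun x => (-1) * dtime u x t +
      h^-1 * ((-1) * u x t + u x (h + t))); last by apply/funext => x; ring.
  rewrite smean_lin //.
  have [B s1B] := smooth_sphere_bounded s1.
  by rewrite (smeanZ _ s1B) smean_lin // /GRing.scale /=; ring.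
apply: DeriveDef; first exact: cvgP C.
exact: cvg_lim C.
Unshelve. all: by end_near. Qed.

Lemma continuous_dotpxx : continuous (fun x : V => dotp x x).
Proof.
move=> y; apply: differentiable_continuous.
apply: (smooth_on_differentiable (A := setT)) => //.
by apply: smooth_on_dotpxx; exact: openT.
Qed.

Lemma near0_dotpxx_small : \forall x \near (0 : V), dotp x x <= 1 / 2.
Proof.
have d0 : dotp (0 : V) 0 < 1 / 2.
  by rewrite (eqP (_ : dotp (0 : V) 0 == 0)) ?dotpxx_eq0 //; lra.
have H : \forall x \near (0 : V), dotp x x < 1 / 2.
  exact: (cvgr_lt _ (@continuous_dotpxx 0)).
by apply: filterS H => x /ltW.
Qed.

Section CutoffField.
Variables (X : S -> R) (i : 'I_n.+1).
Hypothesis sX : smooth_sphere X.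

Let G (x : V) : R := cutoff (dotp x x) * X (retract x).

Definition dcutoff_field (x : V) : R :=
  cutoff (dotp x x) * 'D_(delta_mx 0 i) (X \o @retract R n) x +
  X (retract x) * (dcutoff (dotp x x) * (2 * x 0 i)).

Lemma dcutoff_field_small (x : V) : dotp x x <= 1 / 2 -> dcutoff_field x = 0.
Proof.
move=> h; rewrite /dcutoff_field cutoff_small // mul0r add0r /dcutoff.
rewrite (_ : Num.max _ _ = 0); first by rewrite mulr0 !mul0r mulr0.
by apply/max_idPl; nra.
Qed.

(** Off the origin this is the product rule. At the origin, where radial projection is singular, the
    cutoff makes the function vanish on a whole neighbourhood. *)
Lemma is_derive_cutoff_field (x : V) : is_derive x (delta_mx 0 i) G (dcutoff_field x).
Proof.
have [->|x0] := eqVneq x 0.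
  rewrite dcutoff_field_small; last exact: (nbhs_singleton near0_dotpxx_small).
  apply: (near_eq_is_derive (f := cst 0)).
  by apply: filterS near0_dotpxx_small => y h; rewrite /G cutoff_small // mul0r.
have db : differentiable (cutoff \o (fun y : V => dotp y y)) x.
  apply: differentiable_comp.
    apply: (smooth_on_differentiable (A := setT)) => //.
    by apply: smooth_on_dotpxx; exact: openT.
  by apply/derivable1_diffP; have [] := is_derive_cutoff (dotp x x).
have dX : differentiable (X \o @retract R n) x by exact: smooth_on_differentiable sX x0.
rewrite (_ : G = (cutoff \o (fun y : V => dotp y y)) * (X \o @retract R n)) //.
apply: DeriveDef; first by apply: derivableM; exact: diff_derivable.
rewrite deriveM; try exact: diff_derivable.
rewrite /dcutoff_field /GRing.scale /=; congr (_ + _ * _).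
have dd : differentiable (fun y : V => dotp y y) x.
  apply: (smooth_on_differentiable (A := setT)) => //.
  by apply: smooth_on_dotpxx; exact: openT.
have [dB DB] := is_derive_cutoff (dotp x x).
have dB' : differentiable cutoff (dotp x x) by exact/derivable1_diffP.
rewrite deriveE // diff_comp //= -(deriveE _ dd) derive_dotpxx.
rewrite -[X in 'd _ _ X]mulr1 linearZ /= -deriveE // DB /GRing.scale /= mulrC.
congr (_ * (2 * _)); rewrite /dotp (bigD1 i) //= big1 ?addr0 => [|k /negbTE ki].
  by rewrite mxE !eqxx mulr1.
by rewrite mxE ki andbF mulr0.
Qed.

Lemma continuous_dcutoff_field : continuous dcutoff_field.
Proof.
move=> x; have [->|x0] := eqVneq x 0.
  rewrite /continuous_at dcutoff_field_small; last exact: (nbhs_singleton near0_dotpxx_small).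
  have Z : {near (0 : V), (fun=> 0 : R) =1 dcutoff_field}.
    by apply: filterS near0_dotpxx_small => y h; rewrite dcutoff_field_small.
  exact: (cvg_trans (near_eq_cvg Z) (cvg_cst _)).
have cb : {for x, continuous (fun y : V => cutoff (dotp y y))}.
  apply: (continuous_comp (g := cutoff)); first exact: continuous_dotpxx.
  apply: differentiable_continuous; apply/derivable1_diffP.
  by have [] := is_derive_cutoff (dotp x x).
have cdb : {for x, continuous (fun y : V => dcutoff (dotp y y))}.
  apply: (continuous_comp (g := dcutoff)); first exact: continuous_dotpxx.
  exact: continuous_dcutoff.
have cD : {for x, continuous ('D_(delta_mx 0 i) (X \o @retract R n))}.
  apply: differentiable_continuous.
  exact: smooth_on_differentiable (smooth_on_derive _ sX) x0.
have cX : {for x, continuous (X \o @retract R n)}.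
  by apply: differentiable_continuous; exact: smooth_on_differentiable sX x0.
have cx : {for x, continuous (fun y : V => y 0 i)} by exact: coord_continuous.
have c2 : {for x, continuous (fun=> 2 : R)} by apply: cst_continuous.
exact: (continuousD (continuousM cb cD)
  (continuousM cX (continuousM cdb (continuousM c2 cx)))).
Qed.

Lemma grid_mean_dcutoff_field (e : R) : 0 < e ->
  \forall m \near \oo, `|grid_mean m dcutoff_field| <= e.
Proof.
move=> e0; apply: (grid_mean_derive continuous_dcutoff_field is_derive_cutoff_field) => //.
(* A coordinate of absolute value at least 2 gives |x|^2 >= 4, outside the support of the cutoff. *)
move=> x j xj; rewrite /G cutoff_large ?mul0r //.
have := sqr_ge0 (`|x 0 j| - 2) => H.
apply: le_trans (coord_sqr_le_dotp x j).
by rewrite -real_normK ?num_real //; nra.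
Qed.

End CutoffField.

(** Add up the i-th derivatives of the compactly supported functions cutoff(|x|^2) X_i(x/|x|), whose
    means tend to 0. The terms in which the cutoff is differentiated sum to a multiple of sum_i x_i
    X_i, which is 0 by tangency; the others sum to the weight times the divergence. *)
Lemma smean_divergence (X : 'I_n.+1 -> S -> R) :
  (forall i, smooth_sphere (X i)) ->
  (forall x : S, \sum_i val x 0 i * X i x = 0) ->
  smean (fun x => \sum_i dcoord i (X i) x) = 0.
Proof.
move=> sX tX; apply: ulim_eq0 => e e0.
have e1 : 0 < e / n.+1%:R by rewrite divr_gt0.
have H : \forall m \near \oo, forall i, `|grid_mean m (dcutoff_field (X i) i)| <= e / n.+1%:R.
  by apply: filter_forall => i; exact: grid_mean_dcutoff_field.
apply: filterS H => m H.
rewrite (_ : grid_smean _ _ = \sum_i grid_mean m (dcutoff_field (X i) i)); last first.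
  rewrite -grid_mean_sum; congr grid_mean; apply/funext => x.
  have [x0|x0] := eqVneq x 0.
    have small : dotp x x <= 1 / 2.
      by rewrite x0; exact: (nbhs_singleton near0_dotpxx_small).
    rewrite /weight cutoff_small // !mul0r big1 // => i _.
    by rewrite dcutoff_field_small.
  rewrite big_split /= mulr_sumr [X in _ = _ + X](_ : _ = 0) ?addr0; last first.
    rewrite (eq_bigr (fun i => (dcutoff (dotp x x) * 2 * eucl_norm x) *
        (val (retract x) 0 i * X i (retract x)))); last first.
      move=> i _; rewrite retractE // mxE.
      by have := x0; rewrite -eucl_norm_eq0 => h; field; exact: h.
    by rewrite -mulr_sumr tX mulr0.
  apply: eq_bigr => i _; rewrite dcoord_ext // /weight.
  by have := x0; rewrite -eucl_norm_eq0 => h; field; exact: h.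
apply: le_trans (ler_norm_sum _ _ _) _.
apply: (@le_trans _ _ (\sum_(i < n.+1) e / n.+1%:R)).
  by apply: ler_sum => i _; exact: H.
by rewrite sumr_const card_ord -[leLHS]mulr_natr divfK.
Qed.

(** The divergence theorem is applied to the tangent field g grad f - f grad g, in whose divergence
    the products of first derivatives cancel. *)
Lemma smean_green f g : smooth_sphere f -> smooth_sphere g ->
  smean (fun x => g x * laplace_beltrami f x) =
  smean (fun x => f x * laplace_beltrami g x).
Proof.
move=> sf sg.
have sdf i := smooth_sphere_dcoord i sf; have sdg i := smooth_sphere_dcoord i sg.
have sgf i : smooth_sphere (fun x => g x * dcoord i f x) by exact: smooth_sphere_mul.
have sfg i : smooth_sphere (fun x => f x * dcoord i g x) by exact: smooth_sphere_mul.
have sL : smooth_sphere (fun x => g x * laplace_beltrami f x).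
  by apply: smooth_sphere_mul => //; exact: smooth_sphere_laplace.
have sR : smooth_sphere (fun x => f x * laplace_beltrami g x).
  by apply: smooth_sphere_mul => //; exact: smooth_sphere_laplace.
pose X i x := (-1) * (f x * dcoord i g x) + g x * dcoord i f x.
have sX i : smooth_sphere (X i).
  apply: smooth_sphere_add => //; apply: smooth_sphere_mul => //.
  exact: smooth_sphere_cst.
have tX (x : S) : \sum_i val x 0 i * X i x = 0.
  rewrite (eq_bigr (fun i => (- f x) * (val x 0 i * dcoord i g x) +
      g x * (val x 0 i * dcoord i f x))); last by move=> i _; rewrite /X; ring.
  by rewrite big_split /= -!mulr_sumr !sum_coord_dcoord // !mulr0 addr0.
have := smean_divergence sX tX.
rewrite (_ : (fun x => _) = fun x => (-1) * (f x * laplace_beltrami g x) +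
    g x * laplace_beltrami f x); last first.
  apply/funext => x; rewrite !laplace_beltramiE !mulr_sumr -big_split /=.
  apply: eq_bigr => i _; rewrite dcoordD //; last first.
    by apply: smooth_sphere_mul => //; exact: smooth_sphere_cst.
  rewrite (dcoordZ _ _ _ (sfg i)) (dcoordM _ _ sf (sdg i)) (dcoordM _ _ sg (sdf i)).
  move: (dcoord i (dcoord i g) x) (dcoord i (dcoord i f) x) (dcoord i f x) (dcoord i g x).
  by move: (f x) (g x) => a b c d p q; ring.
rewrite (smean_lin _ sR sL) mulN1r addrC => /eqP.
by rewrite subr_eq0 => /eqP.
Qed.

(** Near [y] the weight exceeds half its value at [y], so the weighted function has a positive lower
    bound on a cube, and a cube contains a fixed proportion of the grid. The hypothesis is a bound
    near [y] because the lemma is applied to the indicator function of a cap. *)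
Lemma smean_gt0 (y : S) f (C c : R) :
  (forall x, `|f x| <= C) -> (forall x, 0 <= f x) -> 0 < c ->
  (\forall x \near val y, c <= f (retract x)) -> 0 < smean f.
Proof.
move=> fC f0 c0 fc.
have y1 : eucl_norm (val y) = 1 := eqP (valP y).
pose w : R := cutoff 1 / 2.
have w0 : 0 < w by rewrite divr_gt0 // cutoff1_gt0.
have c1 : {for val y, continuous (fun x : V => cutoff (dotp x x))}.
  apply: (continuous_comp (g := cutoff)); first exact: continuous_dotpxx.
  apply: differentiable_continuous; apply/derivable1_diffP.
  by have [] := is_derive_cutoff (dotp (val y) (val y)).
have c2 : {for val y, continuous (fun x : V => (eucl_norm x)^-1)}.
  apply: differentiable_continuous.
  exact: smooth_on_differentiable (@smooth_on_inv_norm R n) (sphere_neq0 y).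
have cw : {for val y, continuous weight} by exact: (continuousM c1 c2).
have wy : w < weight (val y).
  by rewrite /weight -eucl_norm_sqr y1 expr1n divr1 /w; have := @cutoff1_gt0 R; lra.
have wc : \forall x \near val y, w * c <= weight x * f (retract x).
  have wn : \forall x \near val y, w < weight x by exact: (cvgr_gt _ cw).
  apply: filterS2 fc wn => x fx wx.
  by rewrite ler_pM // ltW.
move: wc => /nbhs_ballP[r /= r0 Hr].
(* Halving puts the closed cube inside the open ball of the sup norm; the bound 1 is the one that
   [grid_mean_ge] asks for. *)
pose r' := Num.min (r / 2) 1.
have r'0 : 0 < r' by rewrite lt_min divr_gt0 //=.
have r'1 : r' <= 1 by rewrite ge_min lexx orbT.
have yj j : `|val y 0 j| <= 1 by apply: le_trans (norm_coord_le _ _) _; rewrite y1.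
have wc0 : 0 < w * c by rewrite mulr_gt0.
have L0 : 0 < w * c * (r' / 8) ^+ n.+1 by rewrite mulr_gt0 // exprn_gt0 // divr_gt0.
apply: lt_le_trans L0 _; rewrite -[leLHS](@ulim_cst R).
apply: (ulim_le (C := `|w * c * (r' / 8) ^+ n.+1|) _
  (fun m => grid_smean_norm m fC)) => //.
apply: (@grid_mean_ge R n (val y) r' (w * c)) => //.
- by rewrite r'0.
- exact: ltW.
- by move=> x; rewrite mulr_ge0 ?weight_ge0.
- move=> x Hx; apply: Hr; split=> // i j; rewrite (ord1 i) /ball /= distrC.
  apply: le_lt_trans (Hx j) _; rewrite /r' gt_min.
  by apply/orP; left; rewrite ltr_pdivrMr //; lra.
Qed.

End SphericalMean.

(** * Zonal moments *)

Section Oscillator.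
Context {R : realType}.
Implicit Types (m : R -> R) (lam alpha t : R).

(** The condition at 0 leaves only multiples of sin(lam t), or of t when lam = 0; the condition at
    [alpha] then makes the multiple 0. *)
Lemma oscillator_eq0 m (m1 : R -> R) lam alpha :
  (forall t, is_derive t (1 : R) m (m1 t)) ->
  (forall t, is_derive t (1 : R) m1 (- lam ^+ 2 * m t)) ->
  m 0 = 0 -> m alpha = 0 -> alpha != 0 ->
  (lam != 0 -> sin (lam * alpha) != 0) -> forall t, m t = 0.
Proof.
move=> Dm Dm1 m0 ma a0 sa t.
have [lam0|lam0] := eqVneq lam 0.
  have m1c s : m1 s = m1 0.
    apply: is_derive_0_is_cst => x; apply: is_derive_eq (Dm1 x) _.
    by rewrite lam0 expr0n oppr0 mul0r.
  have mE s : m s = m1 0 * s.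
    suff : m s - m1 0 * s = m 0 - m1 0 * 0 by rewrite m0 mulr0 subr0 => /subr0_eq.
    pose g x := m x - m1 0 * x.
    apply: (@is_derive_0_is_cst _ g) => x; rewrite /g.
    have D1 := Dm x; apply: is_derive_eq.
    by rewrite m1c /GRing.scale /=; ring.
  move: ma; rewrite mE => /eqP; rewrite mulf_eq0 (negbTE a0) orbF => /eqP h.
  by rewrite mE h mul0r.
have Dl x : is_derive x (1 : R) (fun s => lam * s) lam.
  by apply: is_derive_eq; rewrite /GRing.scale /=; ring.
have Ds x : is_derive x (1 : R) (fun s => sin (lam * s)) (cos (lam * x) * lam).
  exact: (@is_derive1_comp R sin (fun s => lam * s) x _ _ (is_derive_sin _) (Dl x)).
have Dc x : is_derive x (1 : R) (fun s => cos (lam * s)) (- sin (lam * x) * lam).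
  exact: (@is_derive1_comp R cos (fun s => lam * s) x _ _ (is_derive_cos _) (Dl x)).
(* [A] and [B] say that the vector (m, m1/lam), rotated through the angle lam s, is constant;
   undoing the rotation yields [m]. *)
have A s : m s * cos (lam * s) - lam^-1 * (m1 s * sin (lam * s)) = 0.
  pose g x := m x * cos (lam * x) - lam^-1 * (m1 x * sin (lam * x)).
  have -> : 0 = g 0 by rewrite /g m0 mulr0 sin0; ring.
  apply: (@is_derive_0_is_cst _ g) => x; rewrite /g.
  have D1 := Dm x; have D2 := Dm1 x; have D3 := Ds x; have D4 := Dc x.
  apply: is_derive_eq; rewrite /GRing.scale /=; field; exact: lam0.
have B s : m s * sin (lam * s) + lam^-1 * (m1 s * cos (lam * s)) = lam^-1 * m1 0.
  pose g x := m x * sin (lam * x) + lam^-1 * (m1 x * cos (lam * x)).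
  have -> : lam^-1 * m1 0 = g 0 by rewrite /g m0 mulr0 sin0 cos0; ring.
  apply: (@is_derive_0_is_cst _ g) => x; rewrite /g.
  have D1 := Dm x; have D2 := Dm1 x; have D3 := Ds x; have D4 := Dc x.
  apply: is_derive_eq; rewrite /GRing.scale /=; field; exact: lam0.
have mE s : m s = lam^-1 * m1 0 * sin (lam * s).
  rewrite -(B s) -[LHS]mulr1 -(cos2Dsin2 (lam * s)).
  rewrite (_ : _ * _ = (m s * cos (lam * s) - lam^-1 * (m1 s * sin (lam * s))) *
      cos (lam * s) + (m s * sin (lam * s) + lam^-1 * (m1 s * cos (lam * s))) *
      sin (lam * s)); last by ring.
  by rewrite A mul0r add0r.
move: ma; rewrite mE => /eqP; rewrite mulf_eq0 (negbTE (sa lam0)) orbF => /eqP h.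
by rewrite mE h mul0r.
Qed.

Lemma sin_natpi (N : nat) : sin (N%:R * pi) = 0 :> R.
Proof. by rewrite mulr_natl -[_ *+ _]add0r (alternatingn (@sinDpi R)) sin0 mulr0. Qed.

(** With N the integer part of x/pi, the remainder x - N pi lies in [0, pi), where the sine vanishes
    only at 0. *)
Lemma sin_eq0_natpi (x : R) : 0 <= x -> sin x = 0 -> exists N : nat, x = N%:R * pi.
Proof.
move=> x0 sx; have pi0 := pi_gt0 R.
pose N := Num.truncn (x / pi); exists N.
have xp0 : 0 <= x / pi by rewrite divr_ge0 // ltW.
have N1 : N%:R * pi <= x by rewrite -ler_pdivlMr // -truncn_ge_nat.
have N2 : x < (N%:R + 1) * pi by rewrite -ltr_pdivrMr // natr1; exact: truncnS_gt.
apply/eqP; rewrite eq_le N1 andbT leNgt; apply/negP => Nx.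
have : 0 < sin (x - N%:R * pi).
  by apply: sin_gt0_pi; apply/andP; split; [rewrite subr_gt0|rewrite ltrBlDr; nra].
have := sx; rewrite -{1}(subrK (N%:R * pi) x) [N%:R * pi in X in X = _]mulr_natl.
rewrite (alternatingn (@sinDpi R)) => /eqP; rewrite mulf_eq0 signr_eq0 /= => /eqP.
by rewrite mulr_natl => ->; rewrite ltxx.
Qed.

End Oscillator.

(** * Powers of a zonal function and their moments *)

Section Zonal.
Context {R : realType} {n : nat}.
Local Notation V := ('rV[R]_n.+1).
Local Notation S := (sphere R n).
Implicit Types (f g : S -> R) (u w : S -> R -> R) (x y : S).

Definition zonal y : S -> R := fun x => dotp (val y) (val x).

Lemma smooth_zonal y : smooth_sphere (zonal y).
Proof.
apply: smooth_sphere_sum => i; apply: smooth_sphere_mul.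
  exact: smooth_sphere_cst.
exact: smooth_sphere_coord.
Qed.

Lemma smooth_zonal_exp y k : smooth_sphere (fun x => zonal y x ^+ k).
Proof. by apply: smooth_sphere_exp; exact: smooth_zonal. Qed.

Lemma sphere_dotp x : dotp (val x) (val x) = 1.
Proof. by rewrite -eucl_norm_sqr (eqP (valP x)) expr1n. Qed.

Lemma sum_sqr_coord x : \sum_i val x 0 i ^+ 2 = 1.
Proof. by rewrite -[RHS](sphere_dotp x); apply: eq_bigr => i _; rewrite expr2. Qed.

Lemma dcoord_zonal y i x : dcoord i (zonal y) x = val y 0 i - zonal y x * val x 0 i.
Proof.
rewrite dcoord_sum => [|j]; last first.
  apply: smooth_sphere_mul; first exact: smooth_sphere_cst.
  exact: smooth_sphere_coord.
rewrite (eq_bigr (fun j =>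
  val y 0 j * (i == j)%:R - val y 0 j * val x 0 j * val x 0 i)).
  rewrite sumrB -mulr_suml (bigD1 i) //= big1 ?addr0 ?eqxx ?mulr1 // => j ji.
  by rewrite eq_sym (negbTE ji) mulr0.
move=> j _; rewrite dcoordZ ?dcoord_coord; first by ring.
exact: smooth_sphere_coord.
Qed.

(** For s = <y, x> one has Delta s^k = k(k-1) s^(k-2) |grad s|^2 + k s^(k-1) Delta s, with |grad
    s|^2 = 1 - s^2 and Delta s = - n s. The truncated exponents are harmless, as k(k-1) = 0 for k <=
    1. *)
Lemma laplace_zonal_exp y k x :
  laplace_beltrami (fun x => zonal y x ^+ k) x =
  k%:R * k.-1%:R * zonal y x ^+ k.-2 - k%:R * (k%:R + n%:R - 1) * zonal y x ^+ k.
Proof.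
set s := zonal y.
have ss : smooth_sphere s by exact: smooth_zonal.
have sX i : smooth_sphere (fun x => val x 0 i) by exact: smooth_sphere_coord.
have sc (a : R) : smooth_sphere (fun=> a) by exact: smooth_sphere_cst.
have sse j : smooth_sphere (fun x => s x ^+ j) by exact: smooth_sphere_exp.
have sd i : smooth_sphere (fun x => val y 0 i + (-1) * (s x * val x 0 i)).
  by apply: smooth_sphere_add => //; do 2 apply: smooth_sphere_mul => //.
have Dd i : dcoord i (fun x => val y 0 i + (-1) * (s x * val x 0 i)) x =
    - (s x * (1 - val x 0 i ^+ 2) + val x 0 i * (val y 0 i - s x * val x 0 i)).
  rewrite dcoordD ?dcoord_cst ?add0r //; last by do 2 apply: smooth_sphere_mul => //.
  rewrite dcoordZ ?dcoordM //; last by apply: smooth_sphere_mul.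
  by rewrite dcoord_coord eqxx dcoord_zonal -/s (_ : true%:R = 1 :> R) //; ring.
rewrite laplace_beltramiE.
rewrite (eq_bigr (fun i => k%:R * (k.-1%:R * s x ^+ k.-2 *
      (val y 0 i - s x * val x 0 i) ^+ 2 -
    s x ^+ k.-1 * (s x * (1 - val x 0 i ^+ 2) +
       val x 0 i * (val y 0 i - s x * val x 0 i))))); last first.
  move=> i _; rewrite (_ : dcoord i (fun x => s x ^+ k) =
     fun x => k%:R * (s x ^+ k.-1 * (val y 0 i + (-1) * (s x * val x 0 i)))); last first.
    by apply/funext => z; rewrite dcoord_exp // dcoord_zonal -/s; ring.
  rewrite dcoordZ ?dcoordM // ?Dd; last by apply: smooth_sphere_mul.
  by rewrite dcoord_exp // dcoord_zonal -/s; ring.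
have xy : \sum_i val y 0 i * val x 0 i = s x by [].
have xx := sum_sqr_coord x; have yy := sum_sqr_coord y.
(* This is |grad s|^2. *)
have S1 : \sum_i (val y 0 i - s x * val x 0 i) ^+ 2 = 1 - s x ^+ 2.
  rewrite (eq_bigr (fun i => val y 0 i ^+ 2 - 2 * s x * (val y 0 i * val x 0 i) +
    s x ^+ 2 * val x 0 i ^+ 2)); last by move=> i _; ring.
  by rewrite big_split sumrB /= -!mulr_sumr xx yy xy; ring.
(* This is - Delta s. *)
have S2 : \sum_i (s x * (1 - val x 0 i ^+ 2) +
    val x 0 i * (val y 0 i - s x * val x 0 i)) = n%:R * s x.
  rewrite (eq_bigr (fun i => s x - 2 * s x * val x 0 i ^+ 2 + val y 0 i * val x 0 i));
    last by move=> i _; ring.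
  rewrite big_split sumrB /= -mulr_sumr xx xy sumr_const card_ord -[_ *+ _]mulr_natl.
  by rewrite -natr1; ring.
rewrite -mulr_sumr sumrB -!mulr_sumr S1 S2.
case: k => [|[|k]] /=; first by rewrite !mul0r; ring.
  by rewrite expr0 expr1; ring.
by rewrite !exprS -[k.+2%:R]natr1 -[k.+1%:R]natr1; ring.
Qed.

Lemma smooth_time_mulr w f : smooth_time w -> smooth_sphere f ->
  smooth_time (fun x t => w x t * f x).
Proof.
move=> sw sf; apply: smooth_on_mul => //; first exact: open_punctured_time.
have := smooth_time_mul sf (@smooth_on_cst R R setT 1).
by apply: smooth_on_eq; [exact: open_punctured_time|move=> p _; rewrite /= mulr1].
Qed.

Lemma is_derive_moment w f (t : R) : smooth_time w -> smooth_sphere f ->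
  is_derive t 1 (fun s => smean (fun x => w x s * f x))
    (smean (fun x => dtime w x t * f x)).
Proof.
move=> sw sf; have := smean_dtime t (smooth_time_mulr sw sf).
congr is_derive; congr smean; apply/funext => x.
rewrite /dtime !derive1E; have [dw _] := is_derive_dtime x t sw.
rewrite (_ : (fun s => _) = (f x) *: (w x)); last first.
  by apply/funext => s; rewrite mulrC.
by rewrite deriveZ // mulrC.
Qed.

(** The wave equation trades the second time derivative for the Laplacian, Green's formula moves it
    onto s^k, and k(k+n-1) + ((n-1)/2)^2 = (k + (n-1)/2)^2. *)
Lemma is_derive_moment2 w y k (t : R) : real_wave w ->
  is_derive t 1 (fun s => smean (fun x => dtime w x s * zonal y x ^+ k))
    (k%:R * k.-1%:R * smean (fun x => w x t * zonal y x ^+ k.-2) -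
     (k%:R + (n%:R - 1) / 2) ^+ 2 * smean (fun x => w x t * zonal y x ^+ k)).
Proof.
move=> [sw Ew]; have sz j := smooth_zonal_exp y j.
apply: is_derive_eq (is_derive_moment t (smooth_time_dtime sw) (sz k)) _.
have swt := smooth_time_slice t sw.
have swz j : smooth_sphere (fun x => w x t * zonal y x ^+ j) by exact: smooth_sphere_mul.
have sL : smooth_sphere (fun x => zonal y x ^+ k * laplace_beltrami (w ^~ t) x).
  by apply: smooth_sphere_mul => //; exact: smooth_sphere_laplace.
rewrite (_ : (fun x => _) = fun x =>
    (- ((n%:R - 1) / 2) ^+ 2) * (w x t * zonal y x ^+ k) +
    zonal y x ^+ k * laplace_beltrami (w ^~ t) x); last first.
  by apply/funext => x; rewrite -Ew; ring.
rewrite smean_lin // smean_green //.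
rewrite (_ : (fun x => _ * laplace_beltrami _ x) = fun x =>
    k%:R * k.-1%:R * (w x t * zonal y x ^+ k.-2) +
    (- (k%:R * (k%:R + n%:R - 1)) * (w x t * zonal y x ^+ k))); last first.
  by apply/funext => x; rewrite laplace_zonal_exp; ring.
have sc (a : R) : smooth_sphere (fun=> a) by exact: smooth_sphere_cst.
have [C HC] := smooth_sphere_bounded (swz k).
rewrite smean_lin // ?(smeanZ _ HC); first by field.
exact: smooth_sphere_mul.
Qed.

(** Strong induction on [k]: once the moment of degree k - 2 vanishes for all times, the moment of
    degree k is a free oscillator. In degrees 0 and 1 the coupling coefficient k(k-1) is 0. *)
Lemma moments_eq0 w y (alpha : R) : alpha != 0 -> real_wave w ->
  (forall k : nat, k%:R + (n%:R - 1) / 2 != 0 :> R ->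
     sin ((k%:R + (n%:R - 1) / 2) * alpha) != 0) ->
  (forall x, w x 0 = 0) -> (forall x, w x alpha = 0) ->
  forall k t, smean (fun x => w x t * zonal y x ^+ k) = 0.
Proof.
move=> a0 ww sa w0 wa k; have [sw _] := ww.
have vanish j t : (forall x, w x t = 0) -> smean (fun x => w x t * zonal y x ^+ j) = 0.
  move=> wt; rewrite -[RHS](@smean0 R n); congr smean; apply/funext => x.
  by rewrite wt mul0r.
have [N kN] := ubnP k; elim: N k kN => // N IH k kN.
apply: (oscillator_eq0 (lam := k%:R + (n%:R - 1) / 2) (alpha := alpha)
  (m1 := fun t => smean (fun x => dtime w x t * zonal y x ^+ k))) => //.
- by move=> t; apply: is_derive_moment => //; exact: smooth_zonal_exp.
- move=> t; apply: is_derive_eq (is_derive_moment2 y k t ww) _.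
  case: k kN => [|[|k]] kN; rewrite ?mul0r ?mulr0 ?mul0r; try by ring.
  by rewrite /= IH; [ring|lia].
- exact: vanish.
- exact: vanish.
- exact: sa.
Qed.

(** This follows from |y + x|^2 = 2 + 2s and |y - x|^2 = 2 - 2s. *)
Lemma zonal_le1 y x : `|zonal y x| <= 1.
Proof.
have H (a b : S) : 0 <= 2 + 2 * zonal a b /\ 0 <= 2 - 2 * zonal a b.
  have aa := sphere_dotp a; have bb := sphere_dotp b.
  split.
    have -> : 2 + 2 * zonal a b = \sum_i (val a 0 i + val b 0 i) ^+ 2.
      rewrite (eq_bigr (fun i => val a 0 i ^+ 2 + val b 0 i ^+ 2 +
        2 * (val a 0 i * val b 0 i))); last by move=> i _; ring.
      by rewrite !big_split /= -mulr_sumr !sum_sqr_coord.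
    by apply: sumr_ge0 => i _; exact: sqr_ge0.
  have -> : 2 - 2 * zonal a b = \sum_i (val a 0 i - val b 0 i) ^+ 2.
    rewrite (eq_bigr (fun i => val a 0 i ^+ 2 + val b 0 i ^+ 2 -
      2 * (val a 0 i * val b 0 i))); last by move=> i _; ring.
    by rewrite sumrB big_split /= -mulr_sumr !sum_sqr_coord.
  by apply: sumr_ge0 => i _; exact: sqr_ge0.
by have [] := H y x; rewrite ler_norml => h1 h2; apply/andP; split; lra.
Qed.

Lemma coord_dist_zonal y x i : (val y 0 i - val x 0 i) ^+ 2 <= 2 - 2 * zonal y x.
Proof.
have -> : 2 - 2 * zonal y x = \sum_i (val y 0 i - val x 0 i) ^+ 2.
  rewrite (eq_bigr (fun i => val y 0 i ^+ 2 + val x 0 i ^+ 2 -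
    2 * (val y 0 i * val x 0 i))); last by move=> j _; ring.
  by rewrite sumrB big_split /= -mulr_sumr !sum_sqr_coord.
by rewrite (bigD1 i) //= lerDl; apply: sumr_ge0 => j _; exact: sqr_ge0.
Qed.

End Zonal.

(** * Vanishing moments *)

Section ZonalUniqueness.
Context {R : realType} {n : nat}.
Local Notation V := ('rV[R]_n.+1).
Local Notation S := (sphere R n).
Implicit Types (f g : S -> R) (x y : S).

Lemma zonalyy y : zonal y y = 1.
Proof. exact: sphere_dotp. Qed.

Lemma near_zonal y (d : R) : 0 < d ->
  \forall x \near val y, 1 - d <= zonal y (retract x).
Proof.
move=> d0.
have cz : {for val y, continuous (zonal y \o @retract R n)}.
  apply: differentiable_continuous; apply: smooth_sphere_differentiable.
  exact: smooth_zonal.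
have dy : 1 - d < (zonal y \o @retract R n) (val y).
  by rewrite /= retract_val zonalyy ltrBlDr ltrDl.
have H : \forall x \near val y, 1 - d < (zonal y \o @retract R n) x.
  exact: (cvgr_gt _ cz).
by apply: filterS H => x /ltW.
Qed.

(** Caps about [y] shrink to [y], because |y - x|^2 = 2 - 2s bounds every coordinate difference. *)
Lemma zonal_neighborhood f y (c : R) : smooth_sphere f -> c < f y ->
  exists2 d : R, 0 < d <= 1 & forall x, 1 - d <= zonal y x -> c <= f x.
Proof.
move=> sf cy.
have cf : {for val y, continuous (f \o @retract R n)}.
  by apply: differentiable_continuous; exact: smooth_sphere_differentiable.
have fy : c < (f \o @retract R n) (val y) by rewrite /= retract_val.
have H : \forall x \near val y, c < (f \o @retract R n) x by exact: (cvgr_gt _ cf).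
move: H => /nbhs_ballP[r /= r0 Hr].
(* On the cap, 2 - 2s <= 2d <= r^2/2 < r^2. *)
pose d := Num.min (r ^+ 2 / 4) 1.
have d0 : 0 < d by rewrite lt_min ltr01 divr_gt0 ?exprn_gt0.
have d1 : d <= 1 by rewrite ge_min lexx orbT.
have dr : d <= r ^+ 2 / 4 by rewrite ge_min lexx.
exists d; first by rewrite d0.
move=> x dx; apply: ltW; have := Hr (val x); rewrite /= retract_val; apply.
split=> // i j; rewrite (ord1 i) /ball /=.
rewrite -(@ltr_pXn2r _ 2) ?nnegrE ?(ltW r0) // real_normK ?num_real //.
apply: le_lt_trans (coord_dist_zonal y x j) _.
have r20 : 0 < r ^+ 2 by rewrite exprn_gt0.
by move: (zonal y x) (r ^+ 2) dx dr r20 => s q *; lra.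
Qed.

(** The induction on the exponent of (1 + s)/2 carries an arbitrary extra factor s^j: one factor (1
    + s)/2 splits into the cases j and j + 1. *)
Lemma moments_half_zonal f y : smooth_sphere f ->
  (forall k, smean (fun x => f x * zonal y x ^+ k) = 0) ->
  forall k, smean (fun x => f x * ((1 + zonal y x) / 2) ^+ k) = 0.
Proof.
move=> sf m0 k.
have sh : smooth_sphere (fun x => (1 + zonal y x) / 2).
  apply: smooth_sphere_mul; last exact: smooth_sphere_cst.
  by apply: smooth_sphere_add; [exact: smooth_sphere_cst|exact: smooth_zonal].
suff H j : smean (fun x => f x * ((1 + zonal y x) / 2) ^+ k * zonal y x ^+ j) = 0.
  rewrite -[RHS](H 0%N); congr smean; apply/funext => x.
  by rewrite expr0 mulr1.
elim: k j => [|k IH] j.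
  by rewrite -[RHS](m0 j); congr smean; apply/funext => x; rewrite expr0 mulr1.
have sF i : smooth_sphere (fun x => f x * ((1 + zonal y x) / 2) ^+ k * zonal y x ^+ i).
  apply: smooth_sphere_mul; last exact: smooth_zonal_exp.
  by apply: smooth_sphere_mul => //; exact: smooth_sphere_exp.
have sG : smooth_sphere
    (fun x => 2^-1 * (f x * ((1 + zonal y x) / 2) ^+ k * zonal y x ^+ j.+1)).
  by apply: smooth_sphere_mul => //; exact: smooth_sphere_cst.
have [C HC] := smooth_sphere_bounded (sF j.+1).
rewrite (_ : (fun x => _) = fun x =>
    2^-1 * (f x * ((1 + zonal y x) / 2) ^+ k * zonal y x ^+ j) +
    2^-1 * (f x * ((1 + zonal y x) / 2) ^+ k * zonal y x ^+ j.+1)); last first.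
  by apply/funext => x; rewrite !exprS; move: (_ ^+ k) (_ ^+ j) => a b; field.
by rewrite (smean_lin _ (sF j) sG) (smeanZ _ HC) !IH !mulr0 addr0.
Qed.

(* If [f y > 0], the weights [((1 + s) / 2) ^ N] concentrate at [y] and make the
   mean positive for large [N]. *)
Lemma moments_zonal_le0 f y : smooth_sphere f ->
  (forall k, smean (fun x => f x * zonal y x ^+ k) = 0) -> f y <= 0.
Proof.
move=> sf m0; rewrite leNgt; apply/negP => fy0.
have mh := moments_half_zonal sf m0.
set s := zonal y in m0 mh.
pose c := f y / 2; have c0 : 0 < c by rewrite divr_gt0.
have cf : c < f y by rewrite /c; move: (f y) fy0 => a *; lra.
have [d0 /andP[d00 d01] fd] := zonal_neighborhood sf cf.
(* In terms of the kernel (1 + s)/2, the cap s >= 1 - d0 reads (1 + s)/2 >= 1 - d0/2. *)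
pose d := d0 / 2.
have d_gt0 : 0 < d by rewrite divr_gt0.
have d_le : d <= 1 / 2 by rewrite /d; lra.
have {}fd x : 1 - d <= (1 + s x) / 2 -> c <= f x.
  by move=> h; apply: fd; move: h; rewrite /d -/s; move: (s x) => *; lra.
(* Where the kernel is at least [b], [f] is at least [c]; the smaller cap where it is at least [a]
   supplies the positive contribution. *)
pose a := 1 - d / 2; pose b := 1 - d.
have a0 : 0 < a by rewrite /a; lra.
have b0 : 0 < b by rewrite /b; lra.
have ba : b < a by rewrite /a /b; lra.
pose h x : R := if a <= (1 + s x) / 2 then 1 else 0.
have h01 x : 0 <= h x <= 1 by rewrite /h; case: ifP; rewrite ?lexx ler01.
have hb x : `|h x| <= 1 by have /andP[? ?] := h01 x; rewrite ger0_norm.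
have mh0 : 0 < smean h.
  have h_ge0 x : 0 <= h x by case/andP: (h01 x).
  have d20 : 0 < d / 2 by rewrite divr_gt0.
  apply: (@smean_gt0 R n y h 1 1 hb h_ge0 ltr01).
  have nz := near_zonal y d20.
  apply: filterS nz => x; rewrite -/s => sx.
  by rewrite /h ifT // /a; move: (s _) sx => *; lra.
have [K fK] := smooth_sphere_bounded sf.
have K0 : 0 <= K by exact: le_trans (normr_ge0 _) (fK y).
have s01 x : 0 <= (1 + s x) / 2 <= 1.
  have := zonal_le1 y x; rewrite -/s ler_norml; move: (s x) => q /andP[? ?].
  by apply/andP; split; lra.
(* Three zones: for a kernel at least [a] the product is at least c a^N; between [b] and [a] it is
   nonnegative; below [b] it is at least - K b^N. *)
have low N x : c * a ^+ N * h x + (- (K * b ^+ N)) <= f x * ((1 + s x) / 2) ^+ N.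
  have /andP[k0 k1] := s01 x; have := fK x; rewrite ler_norml => /andP[f1 f2].
  have aN : 0 <= a ^+ N by rewrite exprn_ge0 // ltW.
  have bN : 0 <= b ^+ N by rewrite exprn_ge0 // ltW.
  have kN : 0 <= ((1 + s x) / 2) ^+ N by rewrite exprn_ge0.
  have KbN : 0 <= K * b ^+ N by rewrite mulr_ge0.
  have [kb|kb] := leP b ((1 + s x) / 2).
    have cfx := fd x kb.
    have fx0 : 0 <= f x by apply: le_trans cfx; exact: ltW.
    rewrite /h; case: ifP => [ka|_].
      have akN : a ^+ N <= ((1 + s x) / 2) ^+ N.
        by apply: lerXn2r; rewrite ?nnegrE // ltW.
      apply: (@le_trans _ _ (c * a ^+ N)); first by rewrite mulr1 gerDl oppr_le0.
      by apply: ler_pM => //; exact: ltW.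
    rewrite mulr0 add0r; apply: (@le_trans _ _ 0); first by rewrite oppr_le0.
    exact: mulr_ge0.
  rewrite /h ifF; last by apply/negbTE; rewrite -ltNge (lt_trans kb).
  rewrite mulr0 add0r lerNl -mulNr; apply: (@le_trans _ _ (K * ((1 + s x) / 2) ^+ N)).
    by rewrite ler_wpM2r // lerNl.
  by rewrite ler_wpM2l //; apply: lerXn2r; rewrite ?nnegrE // ltW.
pose one : S -> R := cst 1.
(* Take means in [low], whose right-hand side has mean 0, and divide by a^N. As b/a < 1, the bound
   tends to 0 with growing N, against [mh0]. *)
have ineq N : c * smean h <= K * smean one * (b / a) ^+ N.
  have sfk : smooth_sphere (fun x => f x * ((1 + s x) / 2) ^+ N).
    apply: smooth_sphere_mul => //; apply: smooth_sphere_exp.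
    apply: smooth_sphere_mul; last exact: smooth_sphere_cst.
    by apply: smooth_sphere_add; [exact: smooth_sphere_cst|exact: smooth_zonal].
  have [B HB] := smooth_sphere_bounded sfk.
  have c1 x : `|one x| <= 1 by rewrite normr1.
  have bh x : `|c * a ^+ N * h x| <= `|c * a ^+ N|.
    by rewrite normrM ler_piMr.
  have bc : forall x : S, `|(fun _ : S => - (K * b ^+ N)) x| <= `|K * b ^+ N|.
    by move=> x; rewrite normrN.
  have bs x : `|c * a ^+ N * h x + (- (K * b ^+ N))| <= `|c * a ^+ N| + `|K * b ^+ N|.
    by apply: le_trans (ler_normD _ _) _; rewrite lerD ?normrN.
  have := smean_le bs HB (low N); rewrite mh (smeanD bh bc) (smeanZ _ hb).
  have -> : (fun=> - (K * b ^+ N)) = (fun x : S => - (K * b ^+ N) * one x).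
    by apply/funext => x; rewrite mulr1.
  rewrite (smeanZ _ c1) mulNr subr_le0 => H.
  have aN : 0 < a ^+ N by rewrite exprn_gt0.
  rewrite -(ler_pM2r aN) expr_div_n.
  move: (smean h) (smean one) (a ^+ N) (b ^+ N) aN H => p q a' b' a'0 H.
  rewrite (_ : K * q * (b' / a') * a' = K * b' * q); last by field; rewrite gt_eqF.
  by rewrite mulrAC.
have q1 : `|b / a| < 1.
  by rewrite ger0_norm ?divr_ge0 ?(ltW a0) ?(ltW b0) // ltr_pdivrMr // mul1r.
pose M := `|K * smean one| + 1.
have M0 : 0 < M by rewrite ltr_wpDl.
have e0 : 0 < c * smean h / M by rewrite divr_gt0 // mulr_gt0.
have [N _ /(_ N (leqnn N))] := cvgr0_norm_lt _ (cvg_expr q1) _ e0.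
rewrite /= ltr_pdivlMr // => HN.
have : c * smean h <= `|(b / a) ^+ N| * M.
  apply: le_trans (ineq N) _; apply: le_trans (ler_norm _) _.
  by rewrite normrM mulrC ler_wpM2l // /M lerDl.
by move=> /le_lt_trans/(_ HN); rewrite ltxx.
Qed.

(** The one-sided bound is applied to f and to -f. *)
Lemma moments_zonal_eq0 f y : smooth_sphere f ->
  (forall k, smean (fun x => f x * zonal y x ^+ k) = 0) -> f y = 0.
Proof.
move=> sf m0; apply/eqP; rewrite eq_le moments_zonal_le0 //=.
have sNf : smooth_sphere (fun x => (-1) * f x).
  by apply: smooth_sphere_mul => //; exact: smooth_sphere_cst.
suff : (-1) * f y <= 0 by rewrite mulN1r oppr_le0.
apply: (moments_zonal_le0 sNf) => k.
have sfk : smooth_sphere (fun x => f x * zonal y x ^+ k).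
  by apply: smooth_sphere_mul => //; exact: smooth_zonal_exp.
have [C HC] := smooth_sphere_bounded sfk.
rewrite (_ : (fun x => _) = fun x => (-1) * (f x * zonal y x ^+ k)); last first.
  by apply/funext => x; rewrite mulrA.
by rewrite (smeanZ _ HC) m0 mulr0.
Qed.

Lemma real_wave_eq0 (w : S -> R -> R) (alpha : R) : alpha != 0 -> real_wave w ->
  (forall k : nat, k%:R + (n%:R - 1) / 2 != 0 :> R ->
     sin ((k%:R + (n%:R - 1) / 2) * alpha) != 0) ->
  (forall x, w x 0 = 0) -> (forall x, w x alpha = 0) ->
  forall x t, w x t = 0.
Proof.
move=> a0 ww sa w0 wa x t; have [sw _] := ww.
apply: (moments_zonal_eq0 (smooth_time_slice t sw)) => k.
exact: (moments_eq0 x a0 ww sa w0 wa).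
Qed.

End ZonalUniqueness.

(** * Sectoral harmonics *)

Section Sectoral.
Context {R : realType} {n : nat}.
Local Notation S := (sphere R n).
Variables i0 i1 : 'I_n.+1.
Hypothesis i01 : i0 != i1.

(* [(Re, Im)] of [(x_i0 + i x_i1) ^ k]. *)
Fixpoint sectoral (k : nat) (x : S) : R * R :=
  if k is k'.+1 then
    let: (p, q) := sectoral k' x in
    (val x 0 i0 * p - val x 0 i1 * q, val x 0 i0 * q + val x 0 i1 * p)
  else (1, 0).

Lemma sectoral_axis k (x : S) : val x 0 i0 = 1 -> val x 0 i1 = 0 ->
  sectoral k x = (1, 0).
Proof. by move=> x0 x1; elim: k => //= k ->; rewrite x0 x1; congr pair; ring. Qed.

Let P k x := (sectoral k x).1.
Let Q k x := (sectoral k x).2.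

Let PS k : P k.+1 = fun x => val x 0 i0 * P k x + (-1) * (val x 0 i1 * Q k x).
Proof. by apply/funext => x; rewrite /P /Q /=; case: sectoral => p q /=; ring. Qed.

Let QS k : Q k.+1 = fun x => val x 0 i0 * Q k x + val x 0 i1 * P k x.
Proof. by apply/funext => x; rewrite /P /Q /=; case: sectoral. Qed.

Let sX i : smooth_sphere (fun x : S => val x 0 i).
Proof. exact: smooth_sphere_coord. Qed.

Lemma smooth_sectoral k : smooth_sphere (P k) /\ smooth_sphere (Q k).
Proof.
elim: k => [|k [sP sQ]]; first by split; exact: smooth_sphere_cst.
rewrite PS QS; split; apply: smooth_sphere_add; try exact: smooth_sphere_mul.
by apply: smooth_sphere_mul; [exact: smooth_sphere_cst|exact: smooth_sphere_mul].
Qed.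

Let sP k : smooth_sphere (P k). Proof. by case: (smooth_sectoral k). Qed.
Let sQ k : smooth_sphere (Q k). Proof. by case: (smooth_sectoral k). Qed.
Let sc (a : R) : smooth_sphere (fun _ : S => a). Proof. exact: smooth_sphere_cst. Qed.

(** For z = x_i0 + i x_i1 these are the real and imaginary parts of k (z^(k-1) dz/dx_i - x_i z^k),
    the ambient derivative of z^k minus its radial component. The factor k takes care of the
    truncated exponent at k = 0. *)
Lemma dcoord_sectoral i k x :
  dcoord i (P k) x = k%:R * (P k.-1 x * (i == i0)%:R - Q k.-1 x * (i == i1)%:R -
    P k x * val x 0 i) /\
  dcoord i (Q k) x = k%:R * (Q k.-1 x * (i == i0)%:R + P k.-1 x * (i == i1)%:R -
    Q k x * val x 0 i).
Proof.
elim: k => [|k [IHP IHQ]].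
  by rewrite !mul0r; split; exact: dcoord_cst.
(* The recursion z . z^(k-1) = z^k, multiplied by [k] so that it also holds for k = 0. *)
have E : k%:R * (val x 0 i0 * P k.-1 x - val x 0 i1 * Q k.-1 x) = k%:R * P k x /\
         k%:R * (val x 0 i0 * Q k.-1 x + val x 0 i1 * P k.-1 x) = k%:R * Q k x.
  case: (k) => [|j]; first by rewrite !mul0r.
  by rewrite PS QS /=; split => //; ring.
move: E IHP IHQ => [EP EQ].
rewrite PS QS /= !dcoordD ?dcoordZ ?(dcoordM _ _ (sX _) (sP _))
  ?(dcoordM _ _ (sX _) (sQ _)); try exact: smooth_sphere_mul; last first.
  by apply: smooth_sphere_mul => //; exact: smooth_sphere_mul.
rewrite !dcoord_coord -natr1.
move: (dcoord i (P k) x) (dcoord i (Q k) x) => dP dQ -> ->.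
move: EP EQ; move: (P k x) (Q k x) (P k.-1 x) (Q k.-1 x) (val x 0 i0) (val x 0 i1)
  (val x 0 i) (i == i0)%:R (i == i1)%:R k%:R => p q p' q' X Y z a b K EP EQ.
split.
  rewrite [LHS](_ : _ = (K * (X * p' - Y * q')) * a - (K * (X * q' + Y * p')) * b -
    K * z * (X * p - Y * q) + p * (a - z * X) - q * (b - z * Y)); last by ring.
  by rewrite EP EQ; ring.
rewrite [LHS](_ : _ = (K * (X * q' + Y * p')) * a + (K * (X * p' - Y * q')) * b -
  K * z * (X * q + Y * p) + q * (a - z * X) + p * (b - z * Y)); last by ring.
by rewrite EP EQ; ring.
Qed.

(** The polynomial Re z^k is harmonic and homogeneous of degree k, whence the eigenvalue. In the
    computation the terms of degree k - 2 cancel by the Cauchy-Riemann equations and the sum of x_i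
    T_i P vanishes by Euler's relation. *)
Lemma laplace_sectoral k x :
  laplace_beltrami (P k) x = - (k%:R * (k%:R + n%:R - 1)) * P k x.
Proof.
have sum_ind (F : 'I_n.+1 -> R) j : \sum_i (i == j)%:R * F i = F j.
  rewrite (bigD1 j) //= eqxx mul1r big1 ?addr0 // => i /negbTE ->.
  by rewrite mul0r.
rewrite laplace_beltramiE.
rewrite (eq_bigr (fun i => k%:R * ((i == i0)%:R * dcoord i (P k.-1) x -
    (i == i1)%:R * dcoord i (Q k.-1) x - val x 0 i * dcoord i (P k) x -
    P k x * (1 - val x 0 i ^+ 2)))); last first.
  move=> i _; rewrite [in LHS](_ : dcoord i (P k) = fun z =>
    k%:R * ((i == i0)%:R * P k.-1 z +
      ((- (i == i1)%:R) * Q k.-1 z + (-1) * (P k z * val z 0 i)))); last first.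
    apply/funext => z; rewrite (dcoord_sectoral i k z).1.
    by move: (P k z) (P k.-1 z) (Q k.-1 z) => p p' q'; ring.
  have s1 : smooth_sphere (fun z : S => P k z * val z 0 i) by exact: smooth_sphere_mul.
  have s2 : smooth_sphere (fun z : S => (-1) * (P k z * val z 0 i)).
    exact: smooth_sphere_mul.
  have s3 : smooth_sphere (fun z : S => (- (i == i1)%:R) * Q k.-1 z).
    exact: smooth_sphere_mul.
  have s4 : smooth_sphere (fun z : S => (i == i0)%:R * P k.-1 z).
    exact: smooth_sphere_mul.
  have s5 := smooth_sphere_add s3 s2.
  rewrite (dcoordZ _ _ _ (smooth_sphere_add s4 s5)) (dcoordD _ _ s4 s5).
  rewrite (dcoordD _ _ s3 s2) (dcoordZ _ _ _ (sP _)) (dcoordZ _ _ _ (sQ _)).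
  rewrite (dcoordZ _ _ _ s1) (dcoordM _ _ (sP _) (sX _)) dcoord_coord eqxx.
  rewrite (_ : true%:R = 1 :> R) //.
  move: (dcoord i (P k) x) (dcoord i (P k.-1) x) (dcoord i (Q k.-1) x) => a b c.
  by move: (P k x) (val x 0 i) (i == i0)%:R (i == i1)%:R => p z e e'; ring.
rewrite -mulr_sumr !sumrB -mulr_sumr sumrB sum_sqr_coord sumr_const card_ord.
rewrite (sum_coord_dcoord x (sP k)) !sum_ind.
rewrite (dcoord_sectoral i0 k.-1 x).1 (dcoord_sectoral i1 k.-1 x).2 !eqxx.
rewrite (negbTE i01) eq_sym (negbTE i01).
rewrite (_ : true%:R = 1 :> R) // (_ : false%:R = 0 :> R) //.
case: k => [|k] /=; first by rewrite !mul0r oppr0 mul0r.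
rewrite PS -[_ *+ _]mulr_natl -!natr1.
by move: (P _ x) (Q _ x) (P _ x) (Q _ x) => a b c d; ring.
Qed.

End Sectoral.

(** * Resonant degrees *)

Section Resonance.
Context {R : realType}.

(** The algebra generated by sin(lam t) and cos(lam t) is closed under differentiation. *)
Lemma smooth_on_sin (lam : R) : smooth_on setT (fun t : R => sin (lam * t)).
Proof.
have Dl (x : R) : is_derive x (1 : R) (fun s => lam * s) lam.
  by apply: is_derive_eq; rewrite /GRing.scale /=; ring.
have Ds (x : R) : is_derive x (1 : R) (fun s => sin (lam * s)) (cos (lam * x) * lam).
  exact: (@is_derive1_comp R sin (fun s => lam * s) x _ _ (is_derive_sin _) (Dl x)).
have Dc (x : R) : is_derive x (1 : R) (fun s => cos (lam * s)) (- sin (lam * x) * lam).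
  exact: (@is_derive1_comp R cos (fun s => lam * s) x _ _ (is_derive_cos _) (Dl x)).
(* On the line, the derivative in direction [v] is [v] times the ordinary one. *)
have D (f : R -> R) (l x v : R) : is_derive x 1 f l ->
    differentiable f x /\ 'D_v f x = v * l.
  move=> [/derivable1_diffP d E]; split=> //.
  by rewrite deriveE // -[X in 'd _ _ X]mulr1 linearZ /= -deriveE // E.
pose B (f : R -> R) := f = (fun t => sin (lam * t)) \/ f = (fun t => cos (lam * t)).
apply: (@generated_algebra_smooth R R setT B); last by apply: gen_base; left.
- exact: openT.
- by move=> f [->|->] x _; [case: (D _ _ x 0 (Ds x))|case: (D _ _ x 0 (Dc x))].
- move=> f [->|->] v.
    exists (fun t => (v * lam) * cos (lam * t)).
      by apply: gen_mul; [apply: gen_smooth; exact: smooth_on_cst|apply: gen_base; right].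
    by move=> x _; rewrite (D _ _ x v (Ds x)).2; ring.
  exists (fun t => (- v * lam) * sin (lam * t)).
    by apply: gen_mul; [apply: gen_smooth; exact: smooth_on_cst|apply: gen_base; left].
  by move=> x _; rewrite (D _ _ x v (Dc x)).2; ring.
Qed.

(** Separation of variables: both sides of the equation are - lam^2 times the function, because
    k(k+n-1) + ((n-1)/2)^2 = lam^2. *)
Lemma sectoral_wave n (i0 i1 : 'I_n.+1) k (lam : R) : i0 != i1 ->
  lam = k%:R + (n%:R - 1) / 2 ->
  real_wave (fun (x : sphere R n) t => (sectoral i0 i1 k x).1 * sin (lam * t)).
Proof.
move=> i01 lamE.
have [sP _] := smooth_sectoral (R := R) i0 i1 k.
split; first exact: smooth_time_mul sP (smooth_on_sin lam).
move=> x t; set P := fun y : sphere R n => (sectoral i0 i1 k y).1 in sP *.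
have Dl (s : R) : is_derive s (1 : R) (fun s => lam * s) lam.
  by apply: is_derive_eq; rewrite /GRing.scale /=; ring.
have D1 : dtime (fun y s => P y * sin (lam * s)) =
    fun y s => (P y * lam) * cos (lam * s).
  apply/funext => y; apply/funext => s; rewrite /dtime derive1E.
  have Ds := @is_derive1_comp R sin (fun s => lam * s) s _ _ (is_derive_sin _) (Dl s).
  have E : is_derive s (1 : R) (fun s => P y * sin (lam * s))
      ((P y * lam) * cos (lam * s)).
    by apply: is_derive_eq; rewrite /GRing.scale /=; ring.
  by case: E.
have D2 y s : dtime (fun y s => (P y * lam) * cos (lam * s)) y s =
    - lam ^+ 2 * (P y * sin (lam * s)).
  rewrite /dtime derive1E.
  have Dc := @is_derive1_comp R cos (fun s => lam * s) s _ _ (is_derive_cos _) (Dl s).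
  have E : is_derive s (1 : R) (fun s => P y * lam * cos (lam * s))
      (- lam ^+ 2 * (P y * sin (lam * s))).
    by apply: is_derive_eq; rewrite /GRing.scale /=; ring.
  by case: E.
rewrite D1 D2.
have s0 := @smooth_sphere_cst R n 0.
have L0 : laplace_beltrami (cst (0 : R) : sphere R n -> R) x = 0.
  rewrite laplace_beltramiE big1 // => i _.
  have d0 : dcoord i (cst (0 : R) : sphere R n -> R) = cst 0.
    by apply/funext => y; rewrite dcoord_cst.
  by rewrite d0 dcoord_cst.
rewrite (_ : (fun y => P y * sin (lam * t)) =
    fun y => sin (lam * t) * P y + cst 0 y); last first.
  by apply/funext => y; rewrite addr0 mulrC.
rewrite (laplace_beltrami_lin _ _ sP s0) L0 (laplace_sectoral i01).
by rewrite lamE -/(P x); move: (P x) (sin _) => p s; field.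
Qed.

(** In this form resonance becomes a question about the parity of natural numbers. *)
Lemma shifted_degree k n : (1 <= n)%N ->
  k%:R + (n%:R - 1) / 2 = (2 * k + n.-1)%:R / 2 :> R.
Proof.
by case: n => // n _; rewrite /= natrD natrM -natr1; field.
Qed.

(** Put M = 2k + n - 1. A zero of the sine gives alpha/pi = 2N/M, which is rational. If moreover
    alpha/pi = p/q, then pM = 2Nq is even, whereas p is odd and, n being even, so is M. *)
Lemma nonresonant (alpha : R) n : 0 < alpha -> (1 <= n)%N ->
  irrational (alpha / pi) \/
    (exists p q : nat, [/\ lowest_terms (alpha / pi) p q, ~~ odd n & odd p]) ->
  forall k : nat, k%:R + (n%:R - 1) / 2 != 0 :> R ->
    sin ((k%:R + (n%:R - 1) / 2) * alpha) != 0.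
Proof.
move=> a0 n1 H k; rewrite shifted_degree //.
set M := (2 * k + n.-1)%N => M0.
have {M0} M0 : (0 < M)%N by rewrite lt0n; apply: contraNneq M0 => ->; rewrite mul0r.
have MR : M%:R != 0 :> R by rewrite pnatr_eq0 -lt0n.
have pi0 : (pi : R) != 0 by rewrite gt_eqF // pi_gt0.
apply/eqP => /(sin_eq0_natpi _)[|N NE].
  by rewrite mulr_ge0 ?divr_ge0 // ltW.
have E : alpha / pi = (2 * N)%:R / M%:R.
  apply/eqP; rewrite eqr_div //; apply/eqP; rewrite natrM.
  by move: NE; move: (M%:R) (N%:R) (pi) => a b c; lra.
case: H => [irr|[p [q [[q0 _ pqE] nE pO]]]].
  apply: irr; exists ((2 * N)%:R / M%:R) => //.
  by rewrite E [LHS]fmorph_div /= !ratr_nat.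
move: E; rewrite pqE => E.
have qR : q%:R != 0 :> R by rewrite pnatr_eq0 -lt0n.
have : (p * M)%:R = (2 * N * q)%:R :> R.
  by move/eqP: E; rewrite eqr_div // -!natrM => /eqP.
move=> /eqP; rewrite eqr_nat => /eqP/(congr1 odd).
rewrite !oddM pO /= /M oddD oddM /=.
by case: n n1 nE {M M0 MR NE E} => // n _ /=; rewrite negbK => ->.
Qed.

(** Choose k with 2k + n - 1 = q(n+1). Then lam alpha = (p(n+1)/2) pi, and p(n+1) is even. *)
Lemma resonant (alpha : R) n : (1 <= n)%N ->
  (exists p q : nat, lowest_terms (alpha / pi) p q /\ (~~ odd p \/ odd n)) ->
  exists k : nat, 0 < k%:R + (n%:R - 1) / 2 :> R /\
    sin ((k%:R + (n%:R - 1) / 2) * alpha) = 0.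
Proof.
move=> n1 [p [q [[q0 pq E] par]]].
have ev : ~~ odd (p * n.+1).
  by rewrite oddM /= negb_and negbK; case: par => ->; rewrite ?orbT.
(* For k to exist, q(n+1) must have the parity of n - 1. If n is odd, both are even; if n is even,
   then p is even and q is odd by coprimality. *)
have parq : odd (q * n.+1) = odd n.-1.
  case: n n1 par {ev} => // n _ /=; rewrite oddM /= !negbK.
  case: (boolP (odd n)) => [On|_ _]; last by rewrite andbF.
  case=> // pE; rewrite andbT; apply: contraLR pq => qE.
  rewrite /coprime; apply/eqP => g1.
  have : (2 %| gcdn p q)%N by rewrite dvdn_gcd !dvdn2 pE qE.
  by rewrite g1.
have le : (n.-1 <= q * n.+1)%N.
  by apply: leq_trans (leq_pmull n.+1 q0); rewrite (leq_trans (leq_pred _)).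
pose k := (q * n.+1 - n.-1)./2.
have kE : (2 * k + n.-1 = q * n.+1)%N.
  rewrite /k mul2n halfK oddB // parq addbb subn0 subnK //.
exists k; rewrite shifted_degree // kE; split.
  by rewrite divr_gt0 // ltr0n muln_gt0 q0.
have pi0 : (pi : R) != 0 by rewrite gt_eqF // pi_gt0.
have qR : q%:R != 0 :> R by rewrite pnatr_eq0 -lt0n.
rewrite (_ : _ * alpha = ((p * n.+1)./2)%:R * pi); first exact: sin_natpi.
have -> : alpha = p%:R / q%:R * pi by rewrite -E divfK.
have H2 : (2 * (p * n.+1)./2)%N = (p * n.+1)%N by rewrite mul2n halfK (negbTE ev) subn0.
have : (p * n.+1)%:R = 2 * ((p * n.+1)./2)%:R :> R by rewrite -natrM H2.
rewrite !natrM; move: ((p * n.+1)./2)%:R => h Hh.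
rewrite [LHS](_ : _ = (p%:R * n.+1%:R) / 2 * pi); last first.
  by move: (n.+1%:R : R) => m; field; exact: qR.
by rewrite Hh; field.
Qed.

(** Otherwise [0, 1] would be countable and hence of Lebesgue measure 0. *)
Lemma not_countable_real (f : R -> nat) : ~ injective f.
Proof.
move=> finj; have C : countable [set` `[0, 1 : R]].
  by apply/countable_injP; exists f => x y _ _; exact: finj.
have := countable_lebesgue_measure0 C; rewrite lebesgue_measure_itv /= lte_fin ltr01.
by rewrite oppr0 adde0 => /eqP; rewrite eqe oner_eq0.
Qed.

End Resonance.

Theorem theorem5p4 (R : realType) (alpha : R) (n : nat)
    (alpha_gt0 : 0 < alpha) (n_ge1 : (1 <= n)%N) :
  (irrational (alpha / pi)
     \/ (exists p q : nat,
           [/\ lowest_terms (alpha / pi) p q, ~~ odd n & odd p]) ->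
   forall u v : sphere R n -> R -> R[i],
     wave u -> wave v ->
     snapshot u 0 = snapshot v 0 -> snapshot u alpha = snapshot v alpha ->
     u = v)
  /\
  ((exists p q : nat,
      lowest_terms (alpha / pi) p q /\ (~~ odd p \/ odd n)) ->
   forall u : sphere R n -> R -> R[i], wave u ->
     ~ countable [set v : sphere R n -> R -> R[i] |
                    [/\ wave v, snapshot v 0 = snapshot u 0 &
                        snapshot v alpha = snapshot u alpha]]).
Proof.
split=> [H u v /waveP[ur ui] /waveP[vr vi] uv0 uva|res u wu].
  have nr := nonresonant alpha_gt0 n_ge1 H.
  have a0 : alpha != 0 by rewrite gt_eqF.
  have uv0x x : u x 0 = v x 0 := congr1 (fun f => f x) uv0.
  have uvax x : u x alpha = v x alpha := congr1 (fun f => f x) uva.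
  apply/funext => x; apply/funext => t; apply/eqP; rewrite eq_complex.
  (* The real and imaginary parts of u - v are real waves that vanish at times 0 and [alpha]. *)
  have zr := real_wave_eq0 a0 (real_wave_lin (-1) vr ur) nr.
  have zi := real_wave_eq0 a0 (real_wave_lin (-1) vi ui) nr.
  apply/andP; split; rewrite -subr_eq0 addrC -mulN1r; apply/eqP.
    by apply: zr => y; rewrite mulN1r ?uv0x ?uvax addNr.
  by apply: zi => y; rewrite mulN1r ?uv0x ?uvax addNr.
have [k [lam0 sa]] := resonant n_ge1 res.
set lam := k%:R + _ in lam0 sa.
(* As n >= 1, the first and the last coordinate are distinct. *)
have i01 : (ord0 : 'I_n.+1) != ord_max.
  by rewrite -val_eqE /= eq_sym -lt0n.
pose P (x : sphere R n) := (sectoral ord0 ord_max k x).1.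
have wP : real_wave (fun x t => P x * sin (lam * t)) by exact: sectoral_wave.
move/countable_injP => [f finj].
(* One wave for each real [c]; all have the snapshots of [u], since the sine vanishes at times 0 and
   [alpha]. *)
pose g (c : R) (x : sphere R n) (t : R) : R[i] :=
  u x t + (c * (P x * sin (lam * t)))%:C%C.
have gR c x t : complex.Re (g c x t) = c * (P x * sin (lam * t)) + complex.Re (u x t).
  by rewrite /g; case: (u x t) => a b /=; rewrite addrC.
have gI c x t : complex.Im (g c x t) = complex.Im (u x t).
  by rewrite /g; case: (u x t) => a b /=; rewrite addr0.
have [ur ui] := (waveP u).1 wu.
have wg c : wave (g c).
  apply/waveP; split.
    rewrite (_ : (fun x t => complex.Re (g c x t)) =
      fun x t => c * (P x * sin (lam * t)) + complex.Re (u x t)).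
      exact: real_wave_lin.
    by apply/funext => x; apply/funext => t.
  rewrite (_ : (fun x t => complex.Im (g c x t)) = fun x t => complex.Im (u x t)) //.
  by apply/funext => x; apply/funext => t.
have g0 c t : sin (lam * t) = 0 -> snapshot (g c) t = snapshot u t.
  move=> st; apply/funext => x; rewrite /snapshot /g st !mulr0.
  by rewrite (_ : 0%:C%C = 0) ?addr0.
apply: (@not_countable_real R (f \o g)) => c d /= fcd.
have gA e : g e \in [set v | [/\ wave v, snapshot v 0 = snapshot u 0 &
    snapshot v alpha = snapshot u alpha]].
  by rewrite inE /=; split; [exact: wg|apply: g0; rewrite mulr0 sin0|exact: g0].
have gcd := finj _ _ (gA c) (gA d) fcd.
(* At the pole and at time pi/(2 lam) the added wave takes the value [c], so distinct parameters
   give distinct waves. *)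
have P1 : P (pole n) = 1.
  rewrite /P sectoral_axis //= mxE ?eqxx //.
  by rewrite eq_sym (negbTE i01) andbF.
have := congr1 (fun h => complex.Re (h (pole n) (pi / 2 / lam))) gcd.
rewrite /= !gR P1 [lam * _]mulrC divfK ?gt_eqF // sin_pihalf !mulr1.
by move/addIr.
Qed.
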